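(* Let $p$ be a prime, let $n\in\mathbb{N}$, $n\ge1$, and let $T\in GL(n,\mathbb{Q}_p)$. Let $\overline{T}:\mathcal{S}_n\to\mathcal{S}_n$ be the homeomorphism $\overline{T}(x)=\|T(x)\|_p\,T(x)$. For $a\in\mathbb{Q}_p^n\setminus\{0\}$ with $\|T^{-1}(a)\|_p\ne1$, let $\overline{T}_a:\mathcal{S}_n\to\mathcal{S}_n$ be defined by $\overline{T}_a(x)=\|a+T(x)\|_p\,(a+T(x))$, $x\in\mathcal{S}_n$. Then there exists a compact open subgroup $V\subset\mathbb{Q}_p^n$ such that for all $a\in V\setminus\{0\}$ we have $\|T^{-1}(a)\|_p<1$ and $\overline{T}_a$ is a homeomorphism, and the following hold: (I) If $\overline{T}$ is distal, then $\overline{T}_a$ is distal for all nonzero $a\in V$. (II) If $\overline{T}$ is not distal, then for every neighbourhood $U$ of $0$ contained in $V$, there exists a nonzero $a\in U$ such that $\overline{T}_a$ is not distal.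
   Context: Here $|\cdot|_p$ is the $p$-adic absolute value on $\mathbb{Q}_p$, and for $x=(x_1,\dots,x_n)\in\mathbb{Q}_p^n$, $\|x\|_p=\max_{1\le i\le n}|x_i|_p$. The $p$-adic unit sphere is $\mathcal{S}_n=\{x\in\mathbb{Q}_p^n\mid\|x\|_p=1\}$. For nonzero $v\in\mathbb{Q}_p^n$, $\|v\|_p$ is an integer power $p^m$ of $p$, and in the expression $\|v\|_p\,v$ this power is regarded as the scalar $p^m\in\mathbb{Q}_p$; thus $\|v\|_p\,v$ has norm $1$. The condition $\|T^{-1}(a)\|_p\neq 1$ guarantees $a+T(x)\ne0$ for all $x\in\mathcal{S}_n$. A homeomorphism $\phi$ of a Hausdorff topological space $X$ is distal if for every pair of distinct $x,y\in X$, the closure of $\{(\phi^k(x),\phi^k(y))\mid k\in\mathbb{Z}\}$ in $X\times X$ does not intersect the diagonal $\{(d,d)\mid d\in X\}$. ''Subgroup of $\mathbb{Q}_p^n$'' refers to the additive group. *)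

(* Defs.v *)
From HB Require Import structures.
From mathcomp Require Import all_boot all_order all_algebra.
From mathcomp Require Import all_classical reals topology.

Set Implicit Arguments.
Unset Strict Implicit.
Unset Printing Implicit Defensive.

Import Order.TTheory GRing.Theory Num.Theory.

Local Open Scope classical_set_scope.
Local Open Scope ring_scope.

(* Z_p is the inverse limit of the rings Z/p^k, and Q_p its field of fractions.
   [x k] is the residue mod p^k, in {0, ..., p^k - 1}: the bound and the
   compatibility of the residues are both given by the equation. *)
Definition coherent (p : nat) (x : nat -> nat) : Prop :=
  forall k, (x k.+1 %% p ^ k)%N = x k.

Record padic_int (p : nat) (hp : prime p) := MkPadicInt {
  residue :> nat -> nat;
  _ : `[< coherent p residue >]
}.

Section PadicIntegers.
Variables (p : nat) (hp : prime p).

Local Notation Zp := (padic_int hp).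

HB.instance Definition _ := [isSub for @residue p hp].
HB.instance Definition _ := [Choice of Zp by <:].

Let p_gt0 : (0 < p)%N. Proof. exact: prime_gt0. Qed.
Let pX_gt0 k : (0 < p ^ k)%N. Proof. by rewrite expn_gt0 p_gt0. Qed.

Lemma residueP (x : Zp) : coherent p x.
Proof. by case: x => f fc; apply/asboolP. Qed.

Lemma residue_mod (x : Zp) k : (x k %% p ^ k)%N = x k.
Proof. by rewrite -[x k](residueP x) modn_mod. Qed.

Lemma residueS (x : Zp) k : (x k.+1 = x k %[mod p ^ k])%N.
Proof. by rewrite residueP residue_mod. Qed.

Lemma zp_eq (x y : Zp) : (forall k, x k = y k) -> x = y.
Proof. by move=> xy; apply/val_inj/funext. Qed.

Lemma coherent_mod (f : nat -> nat) :
  (forall k, f k.+1 = f k %[mod p ^ k])%N ->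
  `[< coherent p (fun k => f k %% p ^ k)%N >].
Proof.
move=> fS; apply/asboolP => k.
by rewrite modn_dvdm ?fS // expnS dvdn_mull.
Qed.

Definition mk_zp f fS : Zp := MkPadicInt hp (@coherent_mod f fS).

Lemma nat_compat m k : (m = m %[mod p ^ k])%N. Proof. by []. Qed.

Definition zp_of_nat m : Zp := mk_zp (nat_compat m).

Lemma add_compat (x y : Zp) k : (x k.+1 + y k.+1 = x k + y k %[mod p ^ k])%N.
Proof. by rewrite -modnDm !residueP. Qed.

Definition zp_add (x y : Zp) : Zp := mk_zp (add_compat x y).

Lemma mul_compat (x y : Zp) k : (x k.+1 * y k.+1 = x k * y k %[mod p ^ k])%N.
Proof. by rewrite -modnMm !residueP. Qed.

Definition zp_mul (x y : Zp) : Zp := mk_zp (mul_compat x y).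

Lemma residue_le (x : Zp) k : (x k <= p ^ k)%N.
Proof. by rewrite -residue_mod ltnW // ltn_mod. Qed.

Lemma opp_compat (x : Zp) k :
  (p ^ k.+1 - x k.+1 = p ^ k - x k %[mod p ^ k])%N.
Proof.
apply/eqP; rewrite -(eqn_modDr (x k)); apply/eqP.
rewrite subnK ?residue_le // -modnDmr -residueS modnDmr subnK ?residue_le //.
by rewrite modnn expnS modnMl.
Qed.

Definition zp_opp (x : Zp) : Zp := mk_zp (opp_compat x).

Lemma zp_addA : associative zp_add.
Proof. by move=> x y z; apply: zp_eq => k /=; rewrite modnDml modnDmr addnA. Qed.

Lemma zp_addC : commutative zp_add.
Proof. by move=> x y; apply: zp_eq => k /=; rewrite addnC. Qed.

Lemma zp_add0 : left_id (zp_of_nat 0) zp_add.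
Proof. by move=> x; apply: zp_eq => k /=; rewrite mod0n residue_mod. Qed.

Lemma zp_addN : left_inverse (zp_of_nat 0) zp_opp zp_add.
Proof.
move=> x; apply: zp_eq => k /=.
by rewrite modnDml subnK ?residue_le // modnn mod0n.
Qed.

HB.instance Definition _ :=
  GRing.isZmodule.Build Zp zp_addA zp_addC zp_add0 zp_addN.

Lemma zp_mulA : associative zp_mul.
Proof. by move=> x y z; apply: zp_eq => k /=; rewrite modnMml modnMmr mulnA. Qed.

Lemma zp_mulC : commutative zp_mul.
Proof. by move=> x y; apply: zp_eq => k /=; rewrite mulnC. Qed.

Lemma zp_mul1 : left_id (zp_of_nat 1) zp_mul.
Proof. by move=> x; apply: zp_eq => k /=; rewrite modnMml mul1n residue_mod. Qed.

Lemma zp_mulDl : left_distributive zp_mul zp_add.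
Proof.
by move=> x y z; apply: zp_eq => k /=; rewrite modnMml modnDm mulnDl.
Qed.

Lemma zp_1neq0 : zp_of_nat 1 != 0.
Proof.
apply/eqP => /(congr1 (fun x : Zp => x 1%N)) /=.
by rewrite expn1 mod0n modn_small // prime_gt1.
Qed.

HB.instance Definition _ :=
  GRing.Zmodule_isComNzRing.Build Zp zp_mulA zp_mulC zp_mul1 zp_mulDl zp_1neq0.

Definition zp_unit : pred Zp := fun x => `[< exists y : Zp, y * x = 1 >].

Definition zp_inv (x : Zp) : Zp :=
  if pselect (exists y : Zp, y * x = 1) is left e then projT1 (cid e) else x.

Lemma zp_mulV : {in zp_unit, left_inverse 1 zp_inv *%R}.
Proof.
move=> x /asboolP xu; rewrite /zp_inv; case: pselect => // e.
exact: (projT2 (cid e)).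
Qed.

Lemma zp_unitP (x y : Zp) : y * x = 1 -> zp_unit x.
Proof. by move=> yx; apply/asboolP; exists y. Qed.

Lemma zp_inv_out : {in [predC zp_unit], zp_inv =1 id}.
Proof.
by move=> x /asboolP xu; rewrite /zp_inv; case: pselect.
Qed.

HB.instance Definition _ :=
  GRing.ComNzRing_hasMulInverse.Build Zp zp_mulV zp_unitP zp_inv_out.

Lemma zp_neq0P (x : Zp) : reflect (exists k, x k != 0%N) (x != 0).
Proof.
apply: (iffP idP) => [x0|[k xk]]; last first.
  by apply/eqP => x0; move: xk; rewrite x0 /= mod0n.
apply: contrapT => xn; move/eqP: x0; apply; apply: zp_eq => k /=.
by rewrite mod0n; apply: contrapT => /eqP xk; apply: xn; exists k.
Qed.

Lemma residue_le0 (x : Zp) j k : (j <= k)%N -> x k = 0%N -> x j = 0%N.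
Proof.
move=> /subnK <-; elim: (k - j)%N => // i IH xi; apply: IH.
by rewrite -residueP -addSn xi mod0n.
Qed.

(* The p-adic order: the largest [k] such that [x] is [0] mod p^k. *)
Definition zp_ord (x : Zp) : nat :=
  if pselect (exists k, x k != 0%N) is left e then (ex_minn e).-1 else 0.

Lemma zp_ordP (x : Zp) k : x != 0 -> (x k == 0%N) = (k <= zp_ord x)%N.
Proof.
move=> /zp_neq0P ex; rewrite /zp_ord; case: pselect => // e.
case: ex_minnP => m xm mmin; have m0 : (0 < m)%N.
  by case: m xm {mmin} => //; rewrite -residue_mod expn0 modn1.
rewrite -ltnS prednK //; case: (ltnP k m) => [km|mk].
  by apply/negPn/negP => /mmin; rewrite leqNgt km.
by apply/negbTE; apply: contraNN xm => /eqP /(residue_le0 mk) ->.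
Qed.

Lemma residue_dvd (x : Zp) j k : (j <= k)%N -> (p ^ j %| x k)%N = (x j == 0%N).
Proof.
move=> /subnK <-; elim: (k - j)%N => [|i IH].
  by rewrite add0n /dvdn residue_mod.
rewrite -IH [LHS]/dvdn [RHS]/dvdn; congr (_ == 0%N).
by rewrite addSn -[in RHS](residueP x) modn_dvdm // dvdn_exp2l // leq_addl.
Qed.

Lemma logn_residue (x : Zp) k : x != 0 -> (zp_ord x < k)%N ->
  logn p (x k) = zp_ord x /\ (0 < x k)%N.
Proof.
move=> x0 xk; have : x k != 0%N by rewrite zp_ordP // -ltnNge.
rewrite -lt0n => xk0; split=> //; apply/eqP; rewrite eqn_leq.
rewrite -[(zp_ord x <= _)%N]pfactor_dvdn // (residue_dvd _ (ltnW xk)).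
rewrite zp_ordP // leqnn andbT leqNgt -pfactor_dvdn // residue_dvd //.
by rewrite zp_ordP // ltnn.
Qed.

Lemma zp_mulr_neq0 (x y : Zp) : x != 0 -> y != 0 ->
  x * y != 0 /\ zp_ord (x * y) = (zp_ord x + zp_ord y)%N.
Proof.
move=> x0 y0; pose i := zp_ord x; pose j := zp_ord y.
have mulE k : (x * y) k = ((x k * y k) %% p ^ k)%N by [].
have big m : (i + j < m)%N -> logn p (x m * y m) = (i + j)%N /\ (0 < x m * y m)%N.
  move=> ijm.
  have [lx x1] := logn_residue x0 (leq_ltn_trans (leq_addr _ _) ijm).
  have [ly y1] := logn_residue y0 (leq_ltn_trans (leq_addl _ _) ijm).
  by rewrite lognM // lx ly muln_gt0 x1 y1.
have [lS S0] := big _ (ltnSn (i + j)).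
have xyS : (x * y) (i + j).+1 != 0%N.
  by rewrite mulE -/(dvdn _ _) pfactor_dvdn // lS ltnn.
have xy0 : x * y != 0 by apply/zp_neq0P; exists (i + j).+1.
split => //; apply/eqP; rewrite eqn_leq; apply/andP; split.
  by rewrite leqNgt -zp_ordP.
rewrite -zp_ordP // -(residue_dvd (x * y) (leqnSn _)) mulE.
rewrite /dvdn modn_dvdm ?dvdn_exp2l // -/(dvdn _ _).
by rewrite pfactor_dvdn // lS.
Qed.

Lemma zp_integral (x y : Zp) : x * y = 0 -> (x == 0) || (y == 0).
Proof.
move=> xy; apply/negPn/negP; rewrite negb_or => /andP[x0 y0].
by have [] := zp_mulr_neq0 x0 y0; rewrite xy eqxx.
Qed.

HB.instance Definition _ := GRing.ComUnitRing_isIntegral.Build Zp zp_integral.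

Definition zp_abs (x : Zp) : rat :=
  if x == 0 then 0 else (p%:R ^+ zp_ord x)^-1.

Lemma pR_gt0 : 0 < p%:R :> rat. Proof. by rewrite ltr0n p_gt0. Qed.

Lemma zp_absM (x y : Zp) : zp_abs (x * y) = zp_abs x * zp_abs y.
Proof.
rewrite /zp_abs mulf_eq0; have [->|x0] := eqVneq x 0; first by rewrite /= !mul0r.
have [->|y0] := eqVneq y 0; first by rewrite orbT !mulr0.
by have [_ ->] := zp_mulr_neq0 x0 y0; rewrite /= exprD invfM.
Qed.

Lemma zp_abs_ge0 (x : Zp) : 0 <= zp_abs x.
Proof. by rewrite /zp_abs; case: ifP => // _; rewrite invr_ge0 exprn_ge0. Qed.

Lemma zp_abs_eq0 (x : Zp) : (zp_abs x == 0) = (x == 0).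
Proof.
rewrite /zp_abs; case: ifP => // _.
by rewrite invr_eq0 expf_eq0 (gt_eqF pR_gt0) andbF.
Qed.

Lemma zp_absD (x y : Zp) : zp_abs (x + y) <= Num.max (zp_abs x) (zp_abs y).
Proof.
have [x0|x0] := eqVneq x 0; first by rewrite x0 add0r le_max lexx orbT.
have [y0|y0] := eqVneq y 0; first by rewrite y0 addr0 le_max lexx.
have [xy0|xy0] := eqVneq (x + y) 0.
  by rewrite xy0 {1}/zp_abs eqxx le_max zp_abs_ge0.
have le_abs (z : Zp) : z != 0 -> (zp_ord z <= zp_ord (x + y)%R)%N ->
    zp_abs (x + y) <= zp_abs z.
  move=> z0 zle; rewrite /zp_abs (negbTE xy0) (negbTE z0).
  rewrite lef_pV2 ?qualifE /= ?exprn_gt0 ?pR_gt0 //.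
  by rewrite ler_weXn2l // ler1n.
have addE k : (x + y) k = ((x k + y k) %% p ^ k)%N by [].
rewrite le_max; case: (leqP (zp_ord x) (zp_ord y)) => [xy|/ltnW yx].
  rewrite le_abs // -zp_ordP // addE.
  have /eqP -> : x (zp_ord x) == 0%N by rewrite zp_ordP.
  have /eqP -> : y (zp_ord x) == 0%N by rewrite zp_ordP.
  by rewrite mod0n.
rewrite orbC le_abs // -zp_ordP // addE.
have /eqP -> : x (zp_ord y) == 0%N by rewrite zp_ordP.
have /eqP -> : y (zp_ord y) == 0%N by rewrite zp_ordP.
by rewrite mod0n.
Qed.

Lemma zp_natrE m : (m%:R : Zp) = zp_of_nat m.
Proof.
elim: m => // m IH; rewrite mulrS IH; apply: zp_eq => k /=.
by rewrite modnDm add1n.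
Qed.

Lemma zp_abs_nat m : (0 < m)%N -> zp_abs m%:R = (p%:R ^+ logn p m)^-1.
Proof.
move=> m0; rewrite zp_natrE.
have mk k : (zp_of_nat m k == 0%N) = (k <= logn p m)%N.
  by rewrite /= -/(dvdn _ _) pfactor_dvdn.
have n0 : zp_of_nat m != 0.
  by apply/zp_neq0P; exists (logn p m).+1; rewrite mk ltnn.
rewrite /zp_abs (negbTE n0); congr (_ ^+ _)^-1; apply/eqP.
by rewrite eqn_leq -mk zp_ordP // leqnn -zp_ordP // mk leqnn.
Qed.

End PadicIntegers.

Definition Qp (p : nat) (hp : prime p) : Type := {fraction padic_int hp}.

Section PadicNumbers.
Variables (p : nat) (hp : prime p).

Local Notation Zp := (padic_int hp).
Local Notation Qp := (Qp hp).

HB.instance Definition _ := GRing.Field.on Qp.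

(* The values are 0 and the powers of p, hence rational. *)
Definition qp_abs (x : Qp) : rat :=
  zp_abs \n_(repr x) / zp_abs \d_(repr x).

Lemma qp_abs_pi (r : {ratio Zp}) :
  qp_abs (\pi_{fraction Zp} r)%qT = zp_abs \n_r / zp_abs \d_r.
Proof.
rewrite /qp_abs; set s := repr _.
have /(congr1 (@zp_abs p hp)) : \n_r * \d_s = \d_r * \n_s.
  exact: FracField.equivf_r.
rewrite !zp_absM => rs; apply/eqP.
by rewrite eqr_div ?zp_abs_eq0 ?denom_ratioP // mulrC -rs mulrC.
Qed.

Lemma qp_absM (x y : Qp) : qp_abs (x * y) = qp_abs x * qp_abs y.
Proof.
elim/quotW: x => x; elim/quotW: y => y; rewrite -[_ * _]FracField.pi_mul.
rewrite !qp_abs_pi !numden_Ratio ?mulf_neq0 ?denom_ratioP //.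
by rewrite !zp_absM invfM mulrACA.
Qed.

Lemma qp_absD (x y : Qp) : qp_abs (x + y) <= Num.max (qp_abs x) (qp_abs y).
Proof.
elim/quotW: x => x; elim/quotW: y => y; rewrite -[_ + _]FracField.pi_add.
rewrite !qp_abs_pi !numden_Ratio ?mulf_neq0 ?denom_ratioP //.
have gt0 (r : {ratio Zp}) : 0 < zp_abs \d_r.
  by rewrite lt0r zp_abs_eq0 denom_ratioP zp_abs_ge0.
rewrite zp_absM ler_pdivrMr ?mulr_gt0 //.
apply: le_trans (zp_absD _ _) _.
rewrite maxr_pMl ?mulr_ge0 ?zp_abs_ge0 // !zp_absM.
rewrite [X in _ <= Num.max _ (_ * X)]mulrC.
by rewrite !mulrA !divfK ?gt_eqF // lexx.
Qed.

Lemma qp_abs_ge0 (x : Qp) : 0 <= qp_abs x.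
Proof. by rewrite divr_ge0 ?zp_abs_ge0. Qed.

Lemma qp_abs_int (z : Zp) : qp_abs (FracField.tofrac z) = zp_abs z.
Proof.
have -> : FracField.tofrac z = (\pi_{fraction Zp} (Ratio z 1))%qT by unlock FracField.tofrac.
rewrite qp_abs_pi !numden_Ratio ?oner_eq0 //.
by rewrite (@zp_abs_nat p hp 1) // logn1 expr0 invr1 divr1.
Qed.

Lemma qp_abs_nat m : (0 < m)%N -> qp_abs m%:R = (p%:R ^+ logn p m)^-1.
Proof. by move=> m0; rewrite -zp_abs_nat // -qp_abs_int rmorph_nat. Qed.

Lemma qp_abs0 : qp_abs 0 = 0.
Proof. by rewrite -[0 in LHS]tofrac0 qp_abs_int /zp_abs eqxx. Qed.

Lemma qp_abs1 : qp_abs 1 = 1.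
Proof. by rewrite (@qp_abs_nat 1) // logn1 expr0 invr1. Qed.

Lemma qp_abs_eq0 (x : Qp) : (qp_abs x == 0) = (x == 0).
Proof.
have [->|x0] := eqVneq x 0; first by rewrite qp_abs0 eqxx.
apply/eqP => ax; have := qp_absM x x^-1.
by rewrite ax mul0r divff // qp_abs1 => /eqP; rewrite oner_eq0.
Qed.

Lemma qp_absN (x : Qp) : qp_abs (- x) = qp_abs x.
Proof.
have : qp_abs (-1) ^+ 2 == 1 by rewrite expr2 -qp_absM mulrNN mulr1 qp_abs1.
rewrite sqrf_eq1 -[- x]mulN1r (qp_absM (-1) x) => /orP[/eqP ->|/eqP e]; first by rewrite mul1r.
by have := qp_abs_ge0 (-1); rewrite e.
Qed.

Lemma qp_distC (x y : Qp) : qp_abs (x - y) = qp_abs (y - x).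
Proof. by rewrite -qp_absN opprB. Qed.

Lemma qp_distxx (x : Qp) : qp_abs (x - x) = 0.
Proof. by rewrite subrr qp_abs0. Qed.

Lemma qp_dist_eq0 (x y : Qp) : qp_abs (x - y) = 0 -> x = y.
Proof. by move/eqP; rewrite qp_abs_eq0 subr_eq0 => /eqP. Qed.

Lemma qp_dist_triangle (y x z : Qp) :
  qp_abs (x - z) <= qp_abs (x - y) + qp_abs (y - z).
Proof.
have -> : x - z = (x - y) + (y - z) by rewrite addrA subrK.
apply: le_trans (qp_absD _ _) _.
by rewrite ge_max lerDl lerDr !qp_abs_ge0.
Qed.

HB.instance Definition _ :=
  isMetric.Build rat Qp qp_distxx qp_dist_eq0 qp_distC qp_dist_triangle.

Lemma qp_absV (x : Qp) : x != 0 -> qp_abs x^-1 = (qp_abs x)^-1.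
Proof.
move=> x0; have ax : qp_abs x != 0 by rewrite qp_abs_eq0.
by apply: (mulfI ax); rewrite -qp_absM !divff // qp_abs1.
Qed.

Lemma qp_abs_pow (x : Qp) : x != 0 ->
  exists m, qp_abs x = (p ^ m)%:R \/ qp_abs x = (p ^ m)%:R^-1.
Proof.
have pn0 : (p%:R : rat) != 0 by rewrite gt_eqF // pR_gt0.
rewrite -qp_abs_eq0 /qp_abs mulf_eq0 invr_eq0 !zp_abs_eq0 negb_or.
move=> /andP[n0 d0]; rewrite /zp_abs (negbTE n0) (negbTE d0) invrK.
move: (zp_ord (frac (repr x)).1) (zp_ord (frac (repr x)).2) => i j.
case: (leqP i j) => [ij|/ltnW ji].
  by exists (j - i)%N; left; rewrite natrX -{1}(subnKC ij) exprD mulKf ?expf_neq0.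
by exists (i - j)%N; right; rewrite natrX -{1}(subnK ji) exprD invfM mulfVK ?expf_neq0.
Qed.

Lemma ratr_natV (m : nat) : (0 < m)%N -> ratr m%:R^-1 = m%:R^-1 :> Qp.
Proof.
move=> m0; have mz : (m%:Z : int) != 0 by rewrite eqz_nat -lt0n.
have dE : denq (m%:R^-1) = m%:Z by rewrite -[m%:R]/(m%:Z%:~R) denqVz.
have nE : numq (m%:R^-1) = 1.
  apply: (@intr_inj rat); rewrite numqE dE mulVf //.
  by rewrite pnatr_eq0 -lt0n.
by rewrite /ratr nE dE div1r.
Qed.

(* The scalar [ratr (qp_abs x)] is a power of p, of norm the inverse of the
   norm of x. *)
Lemma qp_abs_ratr_abs (x : Qp) : x != 0 -> qp_abs (ratr (qp_abs x)) = (qp_abs x)^-1.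
Proof.
move=> /qp_abs_pow[m xm]; have pm0 : (0 < p ^ m)%N by rewrite expn_gt0 prime_gt0.
have apm : qp_abs (p ^ m)%:R = (p ^ m)%:R^-1 by rewrite qp_abs_nat // pfactorK // natrX.
have pm1 : ((p ^ m)%:R : Qp) != 0.
  by rewrite -qp_abs_eq0 apm invr_eq0 pnatr_eq0 -lt0n.
case: xm => ->; first by rewrite ratr_nat apm.
by rewrite ratr_natV // qp_absV // apm.
Qed.

End PadicNumbers.

Section PadicSpace.
Variables (p : nat) (hp : prime p) (n : nat).

Local Notation Qp := (Qp hp).

Definition padic_norm (x : 'cV[Qp]_n) : rat :=
  \big[Num.max/0]_(i < n) qp_abs (x i ord0).

Definition padic_sphere : set 'cV[Qp]_n := [set x | padic_norm x = 1].

Definition padic_normalize (v : 'cV[Qp]_n) : 'cV[Qp]_n :=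
  ratr (padic_norm v) *: v.

Definition additive_subgroup (V : set 'cV[Qp]_n) : Prop :=
  V 0 /\ forall x y, V x -> V y -> V (x - y).

(* The default value [x] in [insubd x] only matters when the vector that is
   normalized is 0, which is excluded by the hypotheses of [val_Tbar] and
   [val_Tbar_a]. *)
Definition Tbar (T : 'M[Qp]_n) (x : padic_sphere) : padic_sphere :=
  insubd x (padic_normalize (T *m val x)).

Definition Tbar_a (T : 'M[Qp]_n) (a : 'cV[Qp]_n) (x : padic_sphere) : padic_sphere :=
  insubd x (padic_normalize (a + T *m val x)).

Lemma padic_norm_ge0 (v : 'cV[Qp]_n) : 0 <= padic_norm v.
Proof. exact: bigmax_ge_id. Qed.

Lemma le_padic_norm (v : 'cV[Qp]_n) i : qp_abs (v i ord0) <= padic_norm v.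
Proof. exact: le_bigmax. Qed.

Lemma padic_norm_attained (v : 'cV[Qp]_n) : v != 0 ->
  exists2 i, v i ord0 != 0 & padic_norm v = qp_abs (v i ord0).
Proof.
move=> v0; have [j vj] : exists j, v j ord0 != 0.
  apply: contrapT => vn; move/eqP: v0; apply; apply/colP => j; rewrite mxE.
  by apply: contrapT => /eqP vj; apply: vn; exists j.
have nE : padic_norm v = qp_abs (v [arg max_(i > j) qp_abs (v i ord0)]%O ord0).
  by apply: bigmax_eq_arg => // i _; exact: qp_abs_ge0.
eexists; last exact: nE.
rewrite -qp_abs_eq0 -nE gt_eqF // (lt_le_trans _ (le_padic_norm v j)) //.
by rewrite lt0r qp_abs_eq0 vj qp_abs_ge0.
Qed.

Lemma padic_normZ c (v : 'cV[Qp]_n) : padic_norm (c *: v) = qp_abs c * padic_norm v.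
Proof.
rewrite /padic_norm (big_morph ( *%R (qp_abs c)) (id1 := 0) (op1 := Num.max)).
- by apply: eq_bigr => i _; rewrite mxE qp_absM.
- by move=> x y; rewrite maxr_pMr ?qp_abs_ge0.
- by rewrite mulr0.
Qed.

Lemma padic_norm0 : padic_norm 0 = 0.
Proof. by rewrite -[0 in LHS](scale0r 0) padic_normZ qp_abs0 mul0r. Qed.

Lemma padic_normN (v : 'cV[Qp]_n) : padic_norm (- v) = padic_norm v.
Proof. by rewrite -scaleN1r padic_normZ qp_absN qp_abs1 mul1r. Qed.

Lemma padic_normalize_sphere (v : 'cV[Qp]_n) :
  v != 0 -> padic_normalize v \in padic_sphere.
Proof.
move=> /padic_norm_attained[i vi vE]; rewrite inE /padic_sphere /=.
by rewrite padic_normZ vE qp_abs_ratr_abs // mulVf // qp_abs_eq0.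
Qed.

Lemma val_Tbar (T : 'M[Qp]_n) (x : padic_sphere) : T \in unitmx ->
  val (Tbar T x) = padic_normalize (T *m val x).
Proof.
move=> uT; rewrite insubdK //; apply: padic_normalize_sphere; apply/eqP => Tx.
have := valP x; rewrite inE /padic_sphere /= -[val x](mulKmx uT) Tx mulmx0.
by rewrite padic_norm0 => /eqP; rewrite eq_sym oner_eq0.
Qed.

Lemma val_Tbar_a (T : 'M[Qp]_n) (a : 'cV[Qp]_n) (x : padic_sphere) :
  T \in unitmx -> padic_norm (invmx T *m a) <> 1 ->
  val (Tbar_a T a x) = padic_normalize (a + T *m val x).
Proof.
move=> uT Ta; rewrite insubdK //; apply: padic_normalize_sphere; apply/eqP.
move=> /eqP; rewrite addr_eq0 => /eqP aE; apply: Ta; rewrite aE mulmxN mulKmx //.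
by rewrite padic_normN; have := valP x; rewrite inE.
Qed.

End PadicSpace.

Definition homeomorphism (X Y : topologicalType) (f : X -> Y) : Prop :=
  exists g : Y -> X, [/\ cancel f g, cancel g f, continuous f & continuous g].

(* ['pinv_id setT f] is the inverse of f when f is bijective: see [pinv_cancel]. *)
Definition iterz (X : choiceType) (f : X -> X) (k : int) : X -> X :=
  match k with
  | Posz m => iter m f
  | Negz m => iter m.+1 ('pinv_id setT f)
  end.

Lemma pinv_cancel (X : choiceType) (f g : X -> X) :
  cancel f g -> cancel g f -> 'pinv_id setT f = g.
Proof.
move=> fK gK; apply/funext => x; rewrite -{1}(gK x).
by apply: pinvKV; rewrite ?inE // => y z _ _; apply: (can_inj fK).
Qed.

(* Only meaningful when f is a homeomorphism of a Hausdorff space: otherwise the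
   negative iterates are junk. *)
Definition distal (X : topologicalType) (f : X -> X) : Prop :=
  forall x y : X, x <> y ->
    closure [set (iterz f k x, iterz f k y) | k in [set: int]]
      `&` [set (d, d) | d in [set: X]] = set0.

(* Main.v *)
Require Import Defs.
From mathcomp Require Import all_boot all_order all_algebra ring.
From mathcomp Require Import all_classical reals topology.

(* Call T conformal when N(T^k) N(T^-k), k >= 0, is bounded, N being the maximum
   of the norms of the entries.  Put b = T^-1 a, so that the map is
   x |-> normalize (T (x + b)).

   If T is conformal with bound C and C |b| < 1, then the relation
   "|P (x - y)| <= r |P x| for all powers P of T" is invariant under the map for
   r < 1; two points at distance d satisfy it with r = C d, so points of an orbit
   pair that come within d of each other were within C d from the start, and the
   map is distal.

   If T is not conformal, some limit B of the normalized powers T^k, along an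
   ultrafilter, is singular and commutes with T.  Splitting along the kernel of B
   and induction on the dimension give N(T^j) N(T^k) <= C N(T^(j+k)) for every
   invertible T.  Hence some basis vector w satisfies N(T^m) <= C |T^m w| for all
   m, and for b = c w with c small the orbit of w has the same growth as for
   b = 0.  Starting from w + v with v small in the kernel of B, the difference of
   the two orbits has norm |T^k v| / |T^k w|, which tends to 0 along the
   ultrafilter; so the map is not distal. The case c = 0 is the map of T itself. *)

Set Implicit Arguments.
Unset Strict Implicit.
Unset Printing Implicit Defensive.

Import Order.TTheory GRing.Theory Num.Theory.

Local Open Scope classical_set_scope.
Local Open Scope ring_scope.

(** * The ultrametric maximum norm of matrices *)

Section MatrixNorm.
Variables (p : nat) (hp : prime p).
Local Notation Q := (Qp hp).

Definition mnorm m n (A : 'M[Q]_(m, n)) : rat :=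
  \big[Num.max/0]_(ij : 'I_m * 'I_n) qp_abs (A ij.1 ij.2).

Lemma mnorm_ge0 m n (A : 'M[Q]_(m, n)) : 0 <= mnorm A.
Proof. exact: bigmax_ge_id. Qed.

Lemma le_mnorm m n (A : 'M[Q]_(m, n)) i j : qp_abs (A i j) <= mnorm A.
Proof. exact: (le_bigmax _ (fun ij => qp_abs (A ij.1 ij.2)) (i, j)). Qed.

Lemma mnorm_leP m n (A : 'M[Q]_(m, n)) r : 0 <= r ->
  reflect (forall i j, qp_abs (A i j) <= r) (mnorm A <= r).
Proof.
move=> r0; apply: (iffP idP) => [Ar i j|Ar]; first exact: le_trans (le_mnorm _ _ _) Ar.
by apply/bigmax_leP; split=> // -[i j] _; apply: Ar.
Qed.

Lemma padic_normE n (v : 'cV[Q]_n) : padic_norm v = mnorm v.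
Proof.
apply/eqP; rewrite eq_le; apply/andP; split.
  by apply/bigmax_leP; split=> [|i _]; [exact: mnorm_ge0|exact: le_mnorm].
apply/(mnorm_leP _ (padic_norm_ge0 _)) => i j; rewrite [j]ord1.
exact: le_padic_norm.
Qed.

Lemma mnorm_attained m n (A : 'M[Q]_(m, n)) : A != 0 ->
  exists i j, A i j != 0 /\ mnorm A = qp_abs (A i j).
Proof.
move=> A0; have [i [j Aij]] : exists i j, A i j != 0.
  apply: contrapT => An; move/eqP: A0; apply; apply/matrixP => i j; rewrite mxE.
  by apply: contrapT => /eqP Aij; apply: An; exists i, j.
pose F (ij : 'I_m * 'I_n) := qp_abs (A ij.1 ij.2).
have E : mnorm A = F [arg max_(ij > (i, j)) F ij]%O.
  by apply: bigmax_eq_arg => // ij _; exact: qp_abs_ge0.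
eexists; eexists; split; last exact: E.
rewrite -qp_abs_eq0 -/(F _) -E gt_eqF // (lt_le_trans _ (le_mnorm A i j)) //.
by rewrite lt0r qp_abs_eq0 Aij qp_abs_ge0.
Qed.

Lemma mnorm0 m n : mnorm (0 : 'M[Q]_(m, n)) = 0.
Proof.
apply/eqP; rewrite eq_le mnorm_ge0 andbT; apply/mnorm_leP => // i j.
by rewrite mxE qp_abs0.
Qed.

Lemma mnorm_eq0 m n (A : 'M[Q]_(m, n)) : (mnorm A == 0) = (A == 0).
Proof.
have [->|A0] := eqVneq A 0; first by rewrite mnorm0 eqxx.
have [i [j [Aij ->]]] := mnorm_attained A0.
by rewrite qp_abs_eq0 (negbTE Aij).
Qed.

Lemma mnorm_gt0 m n (A : 'M[Q]_(m, n)) : (0 < mnorm A) = (A != 0).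
Proof. by rewrite lt0r mnorm_eq0 mnorm_ge0 andbT. Qed.

Lemma mnormZ m n c (A : 'M[Q]_(m, n)) : mnorm (c *: A) = qp_abs c * mnorm A.
Proof.
rewrite /mnorm (big_morph ( *%R (qp_abs c)) (id1 := 0) (op1 := Num.max)).
- by apply: eq_bigr => i _; rewrite mxE qp_absM.
- by move=> x y; rewrite maxr_pMr ?qp_abs_ge0.
- by rewrite mulr0.
Qed.

Lemma mnormN m n (A : 'M[Q]_(m, n)) : mnorm (- A) = mnorm A.
Proof. by rewrite -scaleN1r mnormZ qp_absN qp_abs1 mul1r. Qed.

Lemma mnorm_distC m n (A B : 'M[Q]_(m, n)) : mnorm (A - B) = mnorm (B - A).
Proof. by rewrite -mnormN opprB. Qed.

Lemma mnormD m n (A B : 'M[Q]_(m, n)) : mnorm (A + B) <= Num.max (mnorm A) (mnorm B).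
Proof.
apply/mnorm_leP => [|i j]; first by rewrite le_max mnorm_ge0.
rewrite mxE; apply: le_trans (qp_absD _ _) _.
by rewrite ge_max !le_max !le_mnorm orbT.
Qed.

Lemma mnormD_le m n (A B : 'M[Q]_(m, n)) r :
  mnorm A <= r -> mnorm B <= r -> mnorm (A + B) <= r.
Proof. by move=> Ar Br; apply: le_trans (mnormD _ _) _; rewrite ge_max Ar. Qed.

Lemma mnormB_le m n (A B : 'M[Q]_(m, n)) r :
  mnorm A <= r -> mnorm B <= r -> mnorm (A - B) <= r.
Proof. by move=> Ar Br; apply: mnormD_le; rewrite ?mnormN. Qed.

(** Isosceles triangles: A = (A + B) - B, and [B] is too small to account for the norm of [A]. *)
Lemma mnormD_eq m n (A B : 'M[Q]_(m, n)) :
  mnorm B < mnorm A -> mnorm (A + B) = mnorm A.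
Proof.
move=> BA; apply/eqP; rewrite eq_le mnormD_le ?lexx ?(ltW BA) //=.
have := mnormD (A + B) (- B); rewrite addrK mnormN le_max => /orP[->//|].
by rewrite leNgt BA.
Qed.

Lemma mnorm_near m n (A B : 'M[Q]_(m, n)) :
  mnorm (A - B) < mnorm A -> mnorm B = mnorm A.
Proof.
by move=> AB; rewrite -[B](subrK A) addrC mnormD_eq // mnorm_distC.
Qed.

Lemma mnormM m n k (A : 'M[Q]_(m, n)) (B : 'M[Q]_(n, k)) :
  mnorm (A *m B) <= mnorm A * mnorm B.
Proof.
have AB0 : 0 <= mnorm A * mnorm B by rewrite mulr_ge0 ?mnorm_ge0.
apply/mnorm_leP => // i j; rewrite mxE.
elim/big_ind: _ => [|x y xr yr|l _]; first by rewrite qp_abs0.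
  by apply: le_trans (qp_absD _ _) _; rewrite ge_max xr.
by rewrite qp_absM ler_pM ?qp_abs_ge0 ?le_mnorm.
Qed.

Lemma mnorm1_le n : mnorm (1%:M : 'M[Q]_n) <= 1.
Proof.
apply/mnorm_leP => // i j; rewrite mxE.
by case: (_ == _); rewrite ?qp_abs0 ?qp_abs1.
Qed.

Lemma mnorm1 n : (0 < n)%N -> mnorm (1%:M : 'M[Q]_n) = 1.
Proof.
case: n => // n _; apply/eqP; rewrite eq_le mnorm1_le /=.
by have := le_mnorm (1%:M : 'M[Q]_n.+1) ord0 ord0; rewrite mxE qp_abs1.
Qed.

(** The inverse of a largest entry: matrix norms stay in the value group, so rescaling to norm 1 is
    possible. *)
Lemma qp_abs_surj m n (A : 'M[Q]_(m, n)) : A != 0 ->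
  exists c : Q, c != 0 /\ qp_abs c = (mnorm A)^-1.
Proof.
move=> /mnorm_attained[i [j [Aij ->]]]; exists (A i j)^-1.
by rewrite invr_eq0 Aij qp_absV.
Qed.

Lemma mnorm_col m n (A : 'M[Q]_(m, n)) : A != 0 ->
  exists j, mnorm A = mnorm (A *m delta_mx j (0 : 'I_1)).
Proof.
move=> /mnorm_attained[i [j [_ Aij]]]; exists j.
apply/eqP; rewrite eq_le; apply/andP; split.
  have := le_mnorm (A *m delta_mx j (0 : 'I_1)) i 0.
  by rewrite -colE mxE -Aij.
by apply/mnorm_leP => [|k l]; [exact: mnorm_ge0|rewrite -colE mxE le_mnorm].
Qed.

Lemma padic_norm_pow n (v : 'cV[Q]_n) : v != 0 ->
  exists k, padic_norm v = (p ^ k)%:R \/ padic_norm v = (p ^ k)%:R^-1.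
Proof. by move=> /padic_norm_attained[i vi ->]; apply: qp_abs_pow. Qed.

(** The norm is a power of p or the inverse of one; in both forms [ratr] can be evaluated. *)
Lemma ratr_padic_normV n (v : 'cV[Q]_n) : v != 0 ->
  ratr (padic_norm v)^-1 * ratr (padic_norm v) = 1 :> Q.
Proof.
have p0 k : (0 < p ^ k)%N by rewrite expn_gt0 prime_gt0.
have pk0 k : ((p ^ k)%:R : Q) != 0.
  by rewrite -qp_abs_eq0 qp_abs_nat // invr_eq0 expf_eq0 pnatr_eq0 gtn_eqF ?andbF ?prime_gt0.
by move=> /padic_norm_pow[k [->|->]]; rewrite ?invrK ratr_natV // ratr_nat ?mulVf ?mulfV.
Qed.

Lemma mnorm_normalize n (v : 'cV[Q]_n) : v != 0 -> mnorm (padic_normalize v) = 1.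
Proof. by move=> /padic_normalize_sphere; rewrite -padic_normE inE. Qed.

Lemma qp_abs_ratr_norm n (v : 'cV[Q]_n) : v != 0 ->
  qp_abs (ratr (padic_norm v) : Q) = (mnorm v)^-1.
Proof.
move=> v0; apply: (mulIf (x := mnorm v)); first by rewrite mnorm_eq0.
by rewrite mulVf ?mnorm_eq0 // -mnormZ mnorm_normalize.
Qed.

End MatrixNorm.

(** * Limits along ultrafilters *)

Section Limits.
Variables (p : nat) (hp : prime p).
Local Notation Q := (Qp hp).
Local Notation Zp := (padic_int hp).

Let p_gt0 : (0 < p)%N. Proof. exact: prime_gt0. Qed.
Let pr_gt0 : 0 < p%:R :> rat. Proof. by rewrite ltr0n. Qed.

Lemma zp_abs_le (z : Zp) k : (zp_abs z <= (p%:R ^+ k)^-1) = (z k == 0%N).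
Proof.
have [->|z0] := eqVneq z 0.
  by rewrite /zp_abs eqxx invr_ge0 exprn_ge0 ?ler0n //= mod0n eqxx.
rewrite /zp_abs (negbTE z0) zp_ordP // lef_pV2 ?qualifE /= ?exprn_gt0 //.
by rewrite ler_eXn2l // ltr1n prime_gt1.
Qed.

Lemma zp_dist_le (x y : Zp) k : (zp_abs (x - y) <= (p%:R ^+ k)^-1) = (x k == y k).
Proof.
rewrite zp_abs_le; apply/eqP/eqP => [xy|xy].
  have -> : x = (x - y) + y by rewrite subrK.
  move: (x - y) xy => z zk.
  have -> : (z + y) k = ((z k + y k) %% p ^ k)%N by [].
  by rewrite zk add0n residue_mod.
have -> : (x - y) k = ((x k + (- y) k) %% p ^ k)%N by [].
rewrite xy; have <- : (y - y) k = ((y k + (- y) k) %% p ^ k)%N by [].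
by rewrite subrr /= mod0n.
Qed.

(** Modulo p^K, Bezout turns [y] into p^j, where j is the order of [y]; the residue of [x] is a
    multiple of p^j, because [x] is no larger than [y]. *)
Lemma zp_divide_approx (x y : Zp) k : y != 0 -> zp_abs x <= zp_abs y ->
  exists m : nat, zp_abs (x - m%:R * y) <= (p%:R ^+ k)^-1 * zp_abs y.
Proof.
move=> y0; case: k => [|k] xy.
  by exists 0%N; rewrite mul0r subr0 expr0 invr1 mul1r.
have yE : zp_abs y = (p%:R ^+ zp_ord y)^-1 by rewrite /zp_abs (negbTE y0).
(* Precision relative to the norm of [y] costs j more digits. *)
set j := zp_ord y in yE; set K := (k.+1 + j)%N.
have jK : (j < K)%N by rewrite /K addSn ltnS leq_addl.
have [yK yK0] := logn_residue y0 jK.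
have xK : (p ^ j %| x K)%N by rewrite residue_dvd ?(ltnW jK) // -zp_abs_le -yE.
have gE : gcdn (y K) (p ^ K) = (p ^ j)%N.
  have [d pd ->] := pfactor_coprime hp yK0.
  rewrite yK expnD -muln_gcdl; suff /eqP -> : coprime d (p ^ k.+1) by rewrite mul1n.
  by rewrite coprimeXr // coprime_sym.
case: (egcdnP (p ^ K) yK0) => u v; rewrite gE => uv _.
exists (x K %/ p ^ j * u)%N.
rewrite yE -invfM -exprD -/K zp_dist_le zp_natrE; apply/eqP => /=.
by rewrite modnMml -mulnA uv mulnDr mulnA modnMDl divnK // residue_mod.
Qed.

Lemma qp_natr_approx (x : Q) k : qp_abs x <= 1 ->
  exists m : nat, qp_abs (x - m%:R) <= (p%:R ^+ k)^-1.
Proof.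
elim/quotW: x => r; rewrite qp_abs_pi ler_pdivrMr; last first.
  by rewrite lt0r zp_abs_eq0 denom_ratioP zp_abs_ge0.
rewrite mul1r => /(zp_divide_approx k (denom_ratioP r))[m mP]; exists m.
have fE (z : Zp) : FracField.tofrac z = (\pi_{fraction Zp} (Ratio z 1))%qT.
  by unlock FracField.tofrac.
have -> : - m%:R = (\pi_{fraction Zp} (Ratio (- m%:R : Zp) 1))%qT :> Q.
  by rewrite -fE rmorphN rmorph_nat.
rewrite -[_ + _]FracField.pi_add qp_abs_pi !numden_Ratio ?mulr1 ?mulf_neq0 ?denom_ratioP ?oner_eq0 //.
rewrite ler_pdivrMr; last by rewrite lt0r zp_abs_eq0 denom_ratioP zp_abs_ge0.
by rewrite mulNr.
Qed.

(** Otherwise the complements of all fibres are in [F], and so is their empty finite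
    intersection. *)
Lemma ultra_finite_fiber (U : Type) (I : finType) (F : set_system U) (f : U -> I) :
  UltraFilter F -> exists i, F (f @^-1` [set i]).
Proof.
move=> FU; apply: contrapT => noi.
have /filter_ex[t tP] : F [set t | forall i, f t <> i].
  apply: (@filter_forall U I (fun i => [set t | f t <> i])) => i.
  by have [fi|//] := in_ultra_setVsetC (f @^-1` [set i]) FU; case: noi; exists i.
exact: (tP (f t)).
Qed.

(** Natural numbers [g (k, t)] approximate [u t] within p^-k. For each k the ultrafilter selects one
    residue of [g (k, t)] mod p^k; these residues are coherent and so define a p-adic integer, the
    limit. *)
Lemma zp_ultra_limit (U : Type) (F : set_system U) (u : U -> Q) :
  UltraFilter F -> F [set t | qp_abs (u t) <= 1] ->
  exists l, forall k, F [set t | qp_abs (u t - l) <= (p%:R ^+ k)^-1].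
Proof.
move=> FU Fu.
have /choice[g gP] : forall kt : nat * U, exists m : nat,
    qp_abs (u kt.2) <= 1 -> qp_abs (u kt.2 - m%:R) <= (p%:R ^+ kt.1)^-1.
  move=> [k t] /=; have [ut|ut] := pselect (qp_abs (u t) <= 1).
    by have [m mP] := qp_natr_approx k ut; exists m.
  by exists 0%N.
have pk_gt0 k : (0 < p ^ k)%N by rewrite expn_gt0 p_gt0.
have /choice[r rP] : forall k, exists r : nat, F [set t | (g (k, t) = r %[mod p ^ k])%N].
  move=> k.
  have [i iP] := ultra_finite_fiber (fun t => Ordinal (ltn_pmod (g (k, t)) (pk_gt0 k))) FU.
  exists (i : nat); apply: filterS iP => t /(congr1 val) /= <-.
  by rewrite modn_mod.
have nat_dist (a b k : nat) :
    (qp_abs (a%:R - b%:R : Q) <= (p%:R ^+ k)^-1) = (a == b %[mod p ^ k])%N.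
  rewrite -!(rmorph_nat (FracField.tofrac (R := Zp))) -(rmorphB (FracField.tofrac (R := Zp))).
  by rewrite qp_abs_int zp_dist_le !zp_natrE.
have rS k : (r k.+1 = r k %[mod p ^ k])%N.
  (* Some [t] lies in all three large sets, and there both approximations are close to the same
     [u t]. *)
  have [t [[tr tr'] ut]] := filter_ex (filterI (filterI (rP k) (rP k.+1)) Fu).
  rewrite -tr; transitivity (g (k.+1, t) %% p ^ k)%N.
    by move/(congr1 (modn^~ (p ^ k)%N)): tr'; rewrite !modn_dvdm ?dvdn_exp2l.
  apply/eqP; rewrite -nat_dist.
  have -> : (g (k.+1, t))%:R - (g (k, t))%:R = (u t - (g (k, t))%:R) - (u t - (g (k.+1, t))%:R) :> Q by ring.
  apply: le_trans (qp_absD _ _) _; rewrite qp_absN ge_max (gP (k, t)) //=.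
  apply: le_trans (gP (k.+1, t) ut) _.
  by rewrite lef_pV2 ?qualifE /= ?exprn_gt0 // ler_weXn2l // ler1n.
exists (FracField.tofrac (mk_zp hp rS)) => k.
apply: filterS (filterI (rP k) Fu) => t [/= tr ut].
rewrite -[u t](subrK (g (k, t))%:R) -addrA.
apply: le_trans (qp_absD _ _) _; rewrite ge_max (gP (k, t)) //=.
rewrite -(rmorph_nat (FracField.tofrac (R := Zp))) -(rmorphB (FracField.tofrac (R := Zp))).
by rewrite qp_abs_int zp_dist_le zp_natrE /= tr.
Qed.

Lemma rat_pow_small (e : rat) : 0 < e -> exists k, (p%:R ^+ k)^-1 <= e.
Proof.
move=> e0; exists (Num.bound e^-1).
rewrite invf_ple ?qualifE /= ?exprn_gt0 // ?invr_gt0 //.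
have /ltW/le_trans : e^-1 < (Num.bound e^-1)%:R.
  by have := archi_boundP (ltW (_ : 0 < e^-1)); apply; rewrite invr_gt0.
by apply; rewrite -natrX ler_nat ltnW // ltn_expl // prime_gt1.
Qed.

Lemma qp_abs_small (e : rat) : 0 < e -> exists2 c : Q, c != 0 & qp_abs c <= e.
Proof.
move=> /rat_pow_small[k ke]; exists (p ^ k)%:R; last first.
  by rewrite qp_abs_nat ?expn_gt0 ?p_gt0 // pfactorK.
by rewrite -qp_abs_eq0 qp_abs_nat ?expn_gt0 ?p_gt0 // pfactorK // invr_eq0 expf_eq0 gt_eqF ?andbF.
Qed.

(** Multiplication by a small [c] moves the bounded family into the unit ball. *)
Lemma qp_ultra_limit (U : Type) (F : set_system U) (u : U -> Q) r :
  UltraFilter F -> F [set t | qp_abs (u t) <= r] ->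
  exists l, forall e, 0 < e -> F [set t | qp_abs (u t - l) <= e].
Proof.
move=> FU Fu.
have r1 : 0 < Num.max r 1 by rewrite lt_max ltr01 orbT.
have [|c c0 cr] := @qp_abs_small (Num.max r 1)^-1; first by rewrite invr_gt0.
have ac : 0 < qp_abs c by rewrite lt0r qp_abs_eq0 c0 qp_abs_ge0.
have [|l lP] := @zp_ultra_limit U F (fun t => c * u t) FU.
  apply: filterS Fu => t /= tr; rewrite qp_absM.
  have -> : (1 : rat) = (Num.max r 1)^-1 * Num.max r 1 by rewrite mulVf ?gt_eqF.
  by rewrite ler_pM ?qp_abs_ge0 // le_max tr.
exists (c^-1 * l) => e e0; have [|k kP] := @rat_pow_small (qp_abs c * e); first by rewrite mulr_gt0.
apply: filterS (lP k) => t /= tl.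
rewrite -(ler_pM2l ac) -qp_absM mulrBr mulVKf //; exact: le_trans kP.
Qed.

Lemma mx_ultra_limit (U : Type) (F : set_system U) m n (u : U -> 'M[Q]_(m, n)) r :
  UltraFilter F -> F [set t | mnorm (u t) <= r] ->
  exists l, forall e, 0 < e -> F [set t | mnorm (u t - l) <= e].
Proof.
move=> FU Fu.
have /choice[l lP] : forall ij : 'I_m * 'I_n, exists l, forall e, 0 < e ->
    F [set t | qp_abs (u t ij.1 ij.2 - l) <= e].
  move=> ij; apply: (qp_ultra_limit (r := r) FU); apply: filterS Fu => t /= tr.
  exact: le_trans (le_mnorm _ _ _) tr.
exists (\matrix_(i, j) l (i, j)) => e e0.
have : F [set t | forall ij : 'I_m * 'I_n, qp_abs (u t ij.1 ij.2 - l ij) <= e].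
  by apply: filter_forall => ij; apply: lP.
apply: filterS => t tP /=; apply/(mnorm_leP _ (ltW e0)) => i j.
by rewrite !mxE; exact: (tP (i, j)).
Qed.

End Limits.

(** * Sequences that are multiplicative up to a constant *)

Section QuasiMultiplicative.
Variables (a d : nat -> rat) (C : rat).
Hypotheses (C1 : 1 <= C) (a0 : forall i, 0 <= a i) (d0 : forall i, 0 <= d i).
Hypotheses (aM : forall i j, a (i + j)%N <= a i * a j).
Hypotheses (aQ : forall i j, a i * a j <= C * a (i + j)%N).
Hypotheses (dQ : forall i j, d i * d j <= C * d (i + j)%N).

Let C0 : 0 <= C. Proof. exact: le_trans C1. Qed.

(** Comparing at index [i * j] gives d_j^i <= C^i d_(ij) <= C^i a_(ij) <= (C a_j)^i, hence d_j <= C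
    a_j; then a_i a_j <= C a_(i+j) finishes. *)
Lemma quasi_mul_dominated i j : (0 < i)%N -> (0 < j)%N ->
  d (i * j)%N <= a (i * j)%N -> a i * d j <= C ^+ 2 * a (i + j)%N.
Proof.
move=> i0 j0 da.
have dX k : d j ^+ k.+1 <= C ^+ k.+1 * d (k.+1 * j)%N.
  elim: k => [|k IH].
    by rewrite !expr1 mul1n ler_peMl.
  rewrite exprS; apply: le_trans (ler_wpM2l (d0 j) IH) _.
  rewrite mulrCA [C ^+ k.+2]exprSr -[X in _ <= X]mulrA.
  by rewrite ler_wpM2l ?exprn_ge0.
have aX k : a (k.+1 * j)%N <= a j ^+ k.+1.
  elim: k => [|k IH]; first by rewrite expr1 mul1n.
  by rewrite exprS mulSn; apply: le_trans (aM _ _) _; rewrite ler_wpM2l.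
have dj : d j <= C * a j.
  rewrite -(ler_pXn2r i0) ?nnegrE ?mulr_ge0 //.
  case: i i0 da => // i _ da.
  rewrite exprMn; apply: le_trans (dX i) _; rewrite ler_wpM2l ?exprn_ge0 //.
  exact: le_trans da (aX i).
apply: le_trans (ler_wpM2l (a0 i) dj) _.
by rewrite mulrCA expr2 -mulrA ler_wpM2l.
Qed.

End QuasiMultiplicative.

(** Whichever sequence is larger at index [i * j] absorbs the mixed product. A zero index leaves no
    root to take and is treated apart. *)
Lemma quasi_mul_max (a d : nat -> rat) (C : rat) :
  1 <= C -> (forall i, 0 <= a i) -> (forall i, 0 <= d i) -> a 0%N <= 1 -> d 0%N <= 1 ->
  (forall i j, a (i + j)%N <= a i * a j) -> (forall i j, d (i + j)%N <= d i * d j) ->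
  (forall i j, a i * a j <= C * a (i + j)%N) -> (forall i j, d i * d j <= C * d (i + j)%N) ->
  forall i j, a i * d j <= C ^+ 2 * Num.max (a (i + j)%N) (d (i + j)%N).
Proof.
move=> C1 a0 d0 a01 d01 aM dM aQ dQ i j.
have C2 : 1 <= C ^+ 2 by rewrite exprn_ege1.
have C20 : 0 <= C ^+ 2 by rewrite (le_trans _ C2).
have e0 k : 0 <= Num.max (a k) (d k) by rewrite le_max a0.
have [->|i0] := posnP i.
  rewrite add0n; apply: (@le_trans _ _ (d j)); first by rewrite ler_piMl.
  apply: (@le_trans _ _ (Num.max (a j) (d j))); last by rewrite ler_peMl.
  by rewrite le_max lexx orbT.
have [->|j0] := posnP j.
  rewrite addn0; apply: (@le_trans _ _ (a i)); first by rewrite ler_piMr.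
  apply: (@le_trans _ _ (Num.max (a i) (d i))); last by rewrite ler_peMl.
  by rewrite le_max lexx.
have [da|/ltW ad] := leP (d (i * j)%N) (a (i * j)%N).
  apply: le_trans (quasi_mul_dominated C1 a0 d0 aM aQ dQ i0 j0 da) _.
  by rewrite ler_wpM2l // le_max lexx.
rewrite mulrC; rewrite mulnC in ad.
apply: le_trans (quasi_mul_dominated C1 d0 a0 dM dQ aQ j0 i0 ad) _.
by rewrite addnC ler_wpM2l // le_max lexx orbT.
Qed.

(** * Conformal matrices and limits of normalized powers *)

Section Powers.
Variables (p : nat) (hp : prime p).
Local Notation Q := (Qp hp).

Lemma mnorm_small_eq0 m n (A : 'M[Q]_(m, n)) c : 0 <= c ->
  (forall e, 0 < e -> mnorm A <= c * e) -> A = 0.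
Proof.
move=> c0 AP; apply/eqP; rewrite -mnorm_eq0; apply/eqP.
apply/eqP; rewrite eq_le mnorm_ge0 andbT; apply/ler_addgt0Pr => e e0; rewrite add0r.
have c1 : 0 < c + 1 by rewrite ltr_wpDl.
apply: le_trans (AP (e / (c + 1)) _) _; first by rewrite divr_gt0.
by rewrite mulrCA ler_piMr ?(ltW e0) // ler_pdivrMr // mul1r lerDl.
Qed.

Lemma expmxS n (T : 'M[Q]_n) k : T ^+ k.+1 = T *m T ^+ k.
Proof. exact: exprS. Qed.

Lemma expmxSr n (T : 'M[Q]_n) k : T ^+ k.+1 = T ^+ k *m T.
Proof. exact: exprSr. Qed.

Lemma expmxD n (T : 'M[Q]_n) j k : T ^+ (j + k) = T ^+ j *m T ^+ k.
Proof. exact: exprD. Qed.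

Lemma expmx_mulV n (T : 'M[Q]_n) k : T \in unitmx -> T ^+ k *m invmx T ^+ k = 1%:M.
Proof.
move=> uT; elim: k => [|k IH]; first by rewrite !expr0 mulmx1.
by rewrite (expmxSr T) (expmxS (invmx T)) mulmxA -(mulmxA _ T) mulmxV // mulmx1.
Qed.

Lemma expmx_Vmul n (T : 'M[Q]_n) k : T \in unitmx -> invmx T ^+ k *m T ^+ k = 1%:M.
Proof.
move=> uT; elim: k => [|k IH]; first by rewrite !expr0 mulmx1.
by rewrite (expmxSr (invmx T)) (expmxS T) mulmxA -(mulmxA _ (invmx T)) mulVmx // mulmx1.
Qed.

Lemma expmx_neq0 n (T : 'M[Q]_n) k : (0 < n)%N -> T \in unitmx -> T ^+ k != 0.
Proof.
move=> n0 uT; apply/eqP => T0; have := expmx_mulV k uT.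
by rewrite T0 mul0mx => /(congr1 (@mnorm p hp n n))/eqP; rewrite mnorm0 mnorm1 // eq_sym oner_eq0.
Qed.

Lemma mnorm_expD n (T : 'M[Q]_n) j k :
  mnorm (T ^+ (j + k)) <= mnorm (T ^+ j) * mnorm (T ^+ k).
Proof. by rewrite expmxD mnormM. Qed.

Lemma scale_inverse_mx n (c : Q) (A B : 'M[Q]_n) :
  c != 0 -> A *m B = 1%:M -> (c^-1 *: A) *m (c *: B) = 1%:M.
Proof.
by move=> c0 AB; rewrite -scalemxAl -scalemxAr scalerA (mulVf c0) scale1r.
Qed.

Definition conformal n (T : 'M[Q]_n) : Prop :=
  exists C, forall k, mnorm (T ^+ k) * mnorm (invmx T ^+ k) <= C.

Lemma nonconformal_dim n (T : 'M[Q]_n) : ~ conformal T -> (0 < n)%N.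
Proof.
case: n T => // T nT; case: nT; exists 0 => k.
by rewrite [T ^+ k]flatmx0 mnorm0 mul0r.
Qed.

(** Non-conformality makes every set of this nested family nonempty, so the family generates a
    proper filter, contained in an ultrafilter. *)
Lemma nonconformal_ultra n (T : 'M[Q]_n) : ~ conformal T ->
  exists F : set_system nat, UltraFilter F /\
    forall M, F [set k | M < mnorm (T ^+ k) * mnorm (invmx T ^+ k)].
Proof.
move=> nT; pose E (M : rat) := [set k | M < mnorm (T ^+ k) * mnorm (invmx T ^+ k)].
have PF : ProperFilter (filter_from setT E).
  apply: filter_from_proper; last first.
    move=> M _; apply: contrapT => EM; apply: nT; exists M => k.
    by rewrite leNgt; apply/negP => Mk; apply: EM; exists k.
  apply: filter_fromT_filter; first by exists 0.
  move=> M M'; exists (Num.max M M') => k; rewrite /E /= gt_max => /andP[].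
  by split.
have [F [FU FP]] := ultraFilterLemma PF.
by exists F; split=> // M; apply: FP; exists M.
Qed.

(** The finitely many exponents below [m] have products bounded by the sum of them all. *)
Lemma nonconformal_free n (T : 'M[Q]_n) (F : set_system nat) : UltraFilter F ->
  (forall M, F [set k | M < mnorm (T ^+ k) * mnorm (invmx T ^+ k)]) ->
  forall m, F [set k | (m <= k)%N].
Proof.
move=> FU FP m; pose g k := mnorm (T ^+ k) * mnorm (invmx T ^+ k).
have g0 k : 0 <= g k by rewrite mulr_ge0 ?mnorm_ge0.
apply: filterS (FP (\sum_(j < m) g j)) => k /= gk; rewrite leqNgt; apply/negP => km.
move: gk; rewrite ltNge => /negP; apply.
by rewrite (bigD1 (Ordinal km)) //= lerDl sumr_ge0.
Qed.

(** A vector killed by [B] is one whose images under the T^k become negligible against the norm of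
    T^k along [F]. *)
Record degenerate_limit n (T : 'M[Q]_n) (F : set_system nat) (s : nat -> Q) (B : 'M[Q]_n)
  : Prop := DegenerateLimit {
  degenerate_scale : forall k, qp_abs (s k) = (mnorm (T ^+ k))^-1;
  degenerate_lim : forall e, 0 < e -> F [set k | mnorm (s k *: T ^+ k - B) <= e];
  degenerate_comm : T *m B = B *m T;
  degenerate_neq0 : B != 0;
  degenerate_sing : B \notin unitmx
}.

(** The rescaled powers have norm 1 and commute with [T], hence they have a nonzero limit [B] that
    commutes with [T]. Their inverses have norm |T^k| |T^-k|, unbounded along [F], whereas an
    invertible [B] would give them the norm of its own inverse. *)
Lemma nonconformal_limit n (T : 'M[Q]_n) (F : set_system nat) :
  T \in unitmx -> (0 < n)%N -> UltraFilter F ->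
  (forall M, F [set k | M < mnorm (T ^+ k) * mnorm (invmx T ^+ k)]) ->
  exists s B, degenerate_limit T F s B.
Proof.
move=> uT n0 FU FP.
have Tk0 k : T ^+ k != 0 by apply: expmx_neq0.
have /choice[s sP] : forall k, exists c : Q, c != 0 /\ qp_abs c = (mnorm (T ^+ k))^-1.
  by move=> k; apply: qp_abs_surj.
have s0 k : s k != 0 by have [] := sP k.
have sE k : qp_abs (s k) = (mnorm (T ^+ k))^-1 by have [] := sP k.
have s1 k : mnorm (s k *: T ^+ k) = 1 by rewrite mnormZ sE mulVf ?mnorm_eq0.
have [|B BP] := @mx_ultra_limit p hp nat F n n (fun k => s k *: T ^+ k) 1 FU.
  by apply: filterS filterT => k _ /=; rewrite s1.
exists s, B; split=> //.
- apply/eqP; rewrite -subr_eq0; apply/eqP; apply: (mnorm_small_eq0 (mnorm_ge0 T)) => e e0.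
  have [k /= kB] := filter_ex (BP e e0).
  have -> : T *m B - B *m T = (s k *: T ^+ k - B) *m T - T *m (s k *: T ^+ k - B).
    rewrite mulmxBl mulmxBr -scalemxAl -scalemxAr -expmxS -expmxSr.
    by rewrite opprB [RHS]addrC addrA subrK.
  apply: mnormB_le; apply: le_trans (mnormM _ _) _; first by rewrite mulrC ler_wpM2l ?mnorm_ge0.
  by rewrite ler_wpM2l ?mnorm_ge0.
- apply/eqP => B0.
  have [|k] := filter_ex (BP (1 / 2) _); first by [].
  by rewrite /= B0 subr0 s1.
- apply/negP => uB; set b := mnorm (invmx B).
  have b0 : 0 <= b by apply: mnorm_ge0.
  have [|k [/= kB bk]] := filter_ex (filterI (BP (b + 1)^-1 _) (FP b)).
    by rewrite invr_gt0 ltr_wpDl.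
  set V := (s k)^-1 *: invmx T ^+ k.
  have VE : V *m (s k *: T ^+ k) = 1%:M.
    exact: (scale_inverse_mx (s0 k) (expmx_Vmul k uT)).
  have NV : mnorm V = mnorm (T ^+ k) * mnorm (invmx T ^+ k).
    by rewrite mnormZ (qp_absV (s0 k)) sE invrK.
  (* Up to sign, [V] differs from the inverse of [B] by V (s_k T^k - B) B^-1, which is smaller than
     [V] itself. *)
  have : mnorm (invmx B) = mnorm V.
    apply: mnorm_near.
    have -> : V - invmx B = - (V *m (s k *: T ^+ k - B) *m invmx B).
      by rewrite mulmxBr VE mulmxBl mul1mx mulmxK // opprB.
    have V0 : 0 < mnorm V by rewrite NV; apply: le_lt_trans bk.
    rewrite mnormN; apply: le_lt_trans (mnormM _ _) _.
    rewrite -/b; apply: le_lt_trans (ler_wpM2r b0 (mnormM _ _)) _.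
    rewrite -mulrA gtr_pMr //.
    apply: le_lt_trans (ler_wpM2r b0 kB) _.
    by rewrite mulrC ltr_pdivrMr ?mul1r ?ltrDl // ltr_wpDl.
  by move=> bV; move: bk; rewrite -NV -bV -/b ltxx.
Qed.

End Powers.

(** * Quasi-multiplicativity of the powers of an invertible matrix *)

Section QuasiMultiplicativePowers.
Variables (p : nat) (hp : prime p).
Local Notation Q := (Qp hp).

Definition quasi_mul n (T : 'M[Q]_n) (C : rat) : Prop :=
  forall j k, mnorm (T ^+ j) * mnorm (T ^+ k) <= C * mnorm (T ^+ (j + k)).

Lemma quasi_mul_weaken n (T : 'M[Q]_n) C C' : C <= C' -> quasi_mul T C -> quasi_mul T C'.
Proof.
by move=> CC TC j k; apply: le_trans (TC j k) _; rewrite ler_wpM2r ?mnorm_ge0.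
Qed.

(** T^k = T^-j T^(j+k), and the extra factor |T^j| |T^-j| is at most [C]. *)
Lemma conformal_quasi_mul n (T : 'M[Q]_n) C : T \in unitmx ->
  (forall k, mnorm (T ^+ k) * mnorm (invmx T ^+ k) <= C) -> quasi_mul T C.
Proof.
move=> uT TC j k.
have TE : T ^+ k = invmx T ^+ j *m T ^+ (j + k).
  by rewrite expmxD mulmxA (expmx_Vmul j uT) mul1mx.
rewrite [X in _ * mnorm X]TE.
apply: le_trans (ler_wpM2l (mnorm_ge0 _) (mnormM _ _)) _.
by rewrite mulrA ler_wpM2r ?mnorm_ge0.
Qed.

Lemma mnorm_exp_shift n (A : 'M[Q]_n) k : A \in unitmx ->
  mnorm (A ^+ k) <= mnorm (invmx A) * mnorm (A ^+ k.+1).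
Proof.
move=> uA; have AE : A ^+ k = invmx A *m A ^+ k.+1 by rewrite expmxS mulmxA (mulVmx uA) mul1mx.
by rewrite {1}AE mnormM.
Qed.

Section Triangular.
(** The columns of [Y] span an invariant subspace on which [T] acts as [D]; [X] is the projection to
    the quotient, where [T] acts as [A]. The columns of [Y] and [X'] form a basis, with [Y'] and [X]
    as coordinates, in which [T] is block triangular. *)
Variables (n r s : nat) (T : 'M[Q]_n) (A : 'M[Q]_r) (D : 'M[Q]_s).
Variables (X : 'M[Q]_(r, n)) (X' : 'M[Q]_(n, r)) (Y : 'M[Q]_(n, s)) (Y' : 'M[Q]_(s, n)).
Hypotheses (XT : X *m T = A *m X) (TY : T *m Y = Y *m D).
Hypotheses (YX : Y *m Y' + X' *m X = 1%:M) (XX : X *m X' = 1%:M) (YY : Y' *m Y = 1%:M).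
Hypotheses (uA : A \in unitmx) (uD : D \in unitmx).
Variable C : rat.
Hypotheses (C1 : 1 <= C) (AC : quasi_mul A C) (DC : quasi_mul D C).

Let XTk k : X *m T ^+ k = A ^+ k *m X.
Proof.
elim: k => [|k IH]; first by rewrite !expr0 mulmx1 mul1mx.
by rewrite expmxS mulmxA XT -mulmxA IH mulmxA -expmxS.
Qed.

Let TkY k : T ^+ k *m Y = Y *m D ^+ k.
Proof.
elim: k => [|k IH]; first by rewrite !expr0 mulmx1 mul1mx.
by rewrite expmxSr -mulmxA TY mulmxA IH -mulmxA -expmxSr.
Qed.

Let YX0 : Y' *m X' = 0.
Proof.
have E : Y' *m X' *m X = 0.
  have : Y' *m (Y *m Y' + X' *m X) = Y' by rewrite YX mulmx1.
  rewrite mulmxDr !mulmxA YY mul1mx => /eqP.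
  by rewrite -subr_eq0 addrAC subrr add0r => /eqP.
by rewrite -[Y' *m X']mulmx1 -XX mulmxA E mul0mx.
Qed.

(** The off-diagonal block of T^k. *)
Let Z k := Y' *m T ^+ k *m X'.

Let TkX k : T ^+ k *m X' = Y *m Z k + X' *m A ^+ k.
Proof.
rewrite -[LHS]mul1mx -YX mulmxDl /Z !mulmxA; congr (_ + _).
by rewrite -[X' *m X *m _]mulmxA XTk mulmxA -mulmxA XX mulmx1.
Qed.

Let ZS k : Z k.+1 = D *m Z k + Y' *m T *m X' *m A ^+ k.
Proof.
have -> : Z k.+1 = Y' *m T *m (T ^+ k *m X') by rewrite /Z expmxS !mulmxA.
rewrite TkX mulmxDr [Y' *m T *m (X' *m _)]mulmxA [Y' *m T *m (Y *m _)]mulmxA; congr (_ + _).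
by rewrite -[Y' *m T *m Y]mulmxA TY mulmxA YY mul1mx.
Qed.

Let TkE k : T ^+ k = Y *m D ^+ k *m Y' + (Y *m Z k *m X + X' *m A ^+ k *m X).
Proof. by rewrite -mulmxDl -TkX -TkY -!mulmxA -mulmxDr YX mulmx1. Qed.

Let e k := Num.max (mnorm (A ^+ k)) (mnorm (D ^+ k)).
Let e0 k : 0 <= e k. Proof. by rewrite le_max mnorm_ge0. Qed.
Let C0 : 0 <= C. Proof. exact: le_trans C1. Qed.

Let cross j k : mnorm (A ^+ j) * mnorm (D ^+ k) <= C ^+ 2 * e (j + k).
Proof.
apply: (@quasi_mul_max (fun i => mnorm (A ^+ i)) (fun i => mnorm (D ^+ i))) => //.
- by move=> i; apply: mnorm_ge0.
- by move=> i; apply: mnorm_ge0.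
- exact: mnorm1_le.
- exact: mnorm1_le.
- by move=> i l; apply: mnorm_expD.
- by move=> i l; apply: mnorm_expD.
Qed.

Let e_mul j k : e j * e k <= C ^+ 2 * e (j + k).
Proof.
have C2 : C <= C ^+ 2 by rewrite expr2 ler_peMl.
have [jE|jE] : e j = mnorm (A ^+ j) \/ e j = mnorm (D ^+ j).
  by rewrite /e; case: leP; [right|left].
all: have [kE|kE] : e k = mnorm (A ^+ k) \/ e k = mnorm (D ^+ k)
  by rewrite /e; case: leP; [right|left].
all: rewrite jE kE.
- apply: le_trans (AC j k) _; apply: ler_pM => //; first exact: mnorm_ge0.
  by rewrite le_max lexx.
- exact: cross.
- by rewrite mulrC addnC; apply: cross.
- apply: le_trans (DC j k) _; apply: ler_pM => //; first exact: mnorm_ge0.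
  by rewrite le_max lexx orbT.
Qed.

Let e_shift : exists2 K, 0 <= K & forall k, e k <= K * e k.+1.
Proof.
exists (Num.max (mnorm (invmx A)) (mnorm (invmx D))); first by rewrite le_max mnorm_ge0.
move=> k; rewrite {1}/e ge_max; apply/andP; split.
  apply: le_trans (mnorm_exp_shift k uA) _.
  by rewrite ler_pM ?mnorm_ge0 // le_max lexx.
apply: le_trans (mnorm_exp_shift k uD) _.
by rewrite ler_pM ?mnorm_ge0 // le_max lexx orbT.
Qed.

(** Unrolling the recursion of [Z] leaves terms D^i (Y' T X') A^l with i + l = k - 1. Each is
    bounded by the mixed estimate [cross], the ultrametric inequality replaces their sum by a
    maximum, and [e_shift] restores the missing index. *)
Let Z_bound : exists2 K, 0 <= K & forall k, mnorm (Z k) <= K * e k.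
Proof.
have [L L0 LP] := e_shift.
pose z := mnorm (Y' *m T *m X').
have z0 : 0 <= z by apply: mnorm_ge0.
have K0 : 0 <= z * C ^+ 2 * L by rewrite !mulr_ge0 ?exprn_ge0.
exists (z * C ^+ 2 * L) => // k.
(* The factor D^j is there for the induction: each step of the recursion adds one [D] on the
   left. *)
suff H j : mnorm (D ^+ j *m Z k) <= z * C ^+ 2 * L * e (j + k).
  by have := H 0%N; rewrite expr0 mul1mx.
elim: k j => [|k IH] j.
  by rewrite /Z expr0 mulmx1 YX0 mulmx0 mnorm0 mulr_ge0.
rewrite ZS mulmxDr; apply: mnormD_le.
  by rewrite mulmxA -expmxSr addnS -addSn IH.
apply: le_trans (mnormM _ _) _; rewrite mulrC.
apply: le_trans (ler_wpM2r (mnorm_ge0 _) (mnormM _ _)) _.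
have -> : z * C ^+ 2 * L * e (j + k.+1) = z * (C ^+ 2 * (L * e (j + k.+1))) by ring.
rewrite -mulrA ler_wpM2l //.
apply: le_trans (cross k j) _; rewrite ler_wpM2l ?exprn_ge0 //.
by rewrite addnS [(j + k)%N]addnC LP.
Qed.

(** The norm of T^k is comparable to [e k], the larger of the norms of the diagonal blocks, and [e]
    is quasi-multiplicative. *)
Lemma triangular_quasi_mul : exists C', quasi_mul T C'.
Proof.
have [L L0 LP] := Z_bound.
have mY := mnorm_ge0 Y; have mY' := mnorm_ge0 Y'.
have mX := mnorm_ge0 X; have mX' := mnorm_ge0 X'.
pose K := mnorm Y * mnorm Y' + mnorm Y * L * mnorm X + mnorm X' * mnorm X.
have K0 : 0 <= K by rewrite !addr_ge0 ?mulr_ge0.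
have mul3 a b c d (M : 'M[Q]_(a, b)) (N : 'M[Q]_(b, c)) (O : 'M[Q]_(c, d)) x y :
    0 <= x -> mnorm N <= x * y -> mnorm (M *m N *m O) <= mnorm M * x * mnorm O * y.
  move=> x0 Nx; apply: le_trans (mnormM _ _) _.
  have -> : mnorm M * x * mnorm O * y = mnorm M * (x * y) * mnorm O by ring.
  rewrite ler_wpM2r ?mnorm_ge0 //; apply: le_trans (mnormM _ _) _.
  by rewrite ler_wpM2l ?mnorm_ge0.
have Tu k : mnorm (T ^+ k) <= K * e k.
  have ek := e0 k.
  rewrite TkE; apply: mnormD_le; last apply: mnormD_le.
  - apply: le_trans (mul3 _ _ _ _ _ _ _ 1 (e k) ler01 _) _.
      by rewrite mul1r le_max lexx orbT.
    by rewrite mulr1 ler_wpM2r // /K -addrA lerDl addr_ge0 ?mulr_ge0.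
  - apply: le_trans (mul3 _ _ _ _ _ _ _ L (e k) L0 (LP k)) _.
    by rewrite ler_wpM2r // /K -addrA addrCA lerDl addr_ge0 ?mulr_ge0.
  - apply: le_trans (mul3 _ _ _ _ _ _ _ 1 (e k) ler01 _) _.
      by rewrite mul1r le_max lexx.
    by rewrite mulr1 ler_wpM2r // /K lerDr addr_ge0 ?mulr_ge0.
pose K' := mnorm X * mnorm X' + mnorm Y' * mnorm Y.
have K'0 : 0 <= K' by rewrite addr_ge0 ?mulr_ge0.
have Tl k : e k <= K' * mnorm (T ^+ k).
  have t0 := mnorm_ge0 (T ^+ k).
  rewrite /e ge_max; apply/andP; split.
    have -> : A ^+ k = X *m T ^+ k *m X' by rewrite XTk -mulmxA XX mulmx1.
    apply: le_trans (mul3 _ _ _ _ _ _ _ 1 (mnorm (T ^+ k)) ler01 _) _; first by rewrite mul1r.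
    by rewrite mulr1 ler_wpM2r // lerDl mulr_ge0.
  have -> : D ^+ k = Y' *m T ^+ k *m Y by rewrite -mulmxA TkY mulmxA YY mul1mx.
  apply: le_trans (mul3 _ _ _ _ _ _ _ 1 (mnorm (T ^+ k)) ler01 _) _; first by rewrite mul1r.
  by rewrite mulr1 ler_wpM2r // lerDr mulr_ge0.
exists (K * K * (C ^+ 2 * K')) => j k.
apply: le_trans (ler_pM (mnorm_ge0 _) (mnorm_ge0 _) (Tu j) (Tu k)) _.
rewrite mulrACA -[X in _ <= X]mulrA ler_wpM2l ?mulr_ge0 //.
apply: le_trans (e_mul j k) _.
by rewrite -mulrA ler_wpM2l ?exprn_ge0.
Qed.

End Triangular.

(** Strong induction on the dimension. If [T] is not conformal, the singular nonzero [B] commuting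
    with [T] has a proper nonzero invariant column space; [T] is triangular with respect to it, and
    both diagonal blocks are invertible and smaller. *)
Lemma exists_quasi_mul n (T : 'M[Q]_n) : T \in unitmx -> exists2 C, 1 <= C & quasi_mul T C.
Proof.
move=> uT; suff [C TC] : exists C, quasi_mul T C.
  exists (Num.max C 1); first by rewrite le_max lexx orbT.
  by apply: quasi_mul_weaken TC; rewrite le_max lexx.
elim/ltn_ind: n => n IHn in T uT *.
have [[C TC]|nT] := pselect (conformal T).
  by exists C; apply: conformal_quasi_mul.
have n0 := nonconformal_dim nT.
have [F [FU FP]] := nonconformal_ultra nT.
have [s [B [_ _ TB B0 uB]]] := nonconformal_limit uT n0 FU FP.
have rB : (\rank B < n)%N.
  rewrite ltn_neqAle rank_leq_row andbT; apply: contraNneq uB => rB.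
  by rewrite -row_free_unit /row_free rB.
have rB0 : (0 < \rank B)%N by rewrite lt0n mxrank_eq0.
have rX : (\rank (kermx B) < n)%N by rewrite mxrank_ker ltn_subrL rB0.
(* The rows of [X] are a basis of the linear forms vanishing on the column space of [B], so [X]
   presents the quotient. *)
pose X := row_base (kermx B).
pose Y := col_base B; pose R := row_base B.
have YR : Y *m R = B by apply: mulmx_base.
pose Y' := pinvmx Y; pose R' := pinvmx R.
have YY : Y' *m Y = 1%:M by apply: mulVpmx; apply: col_base_full.
have RR : R *m R' = 1%:M by apply: mulmxVp; apply: row_base_free.
have XB : X *m B = 0.
  by apply/eqP; rewrite -sub_kermx eq_row_base.
have Xfree : row_free X by apply: row_base_free.
have Xker m (P : 'M_(m, n)) : P *m B = 0 -> P *m pinvmx X *m X = P.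
  by move=> PB; apply: mulmxKpV; rewrite eq_row_base sub_kermx PB.
move: rB rX X Y R Y' R' YR YY RR XB Xfree Xker => {rB0}.
move: (\rank B) (\rank (kermx B)) => d r rB rX X Y R Y' R' YR YY RR XB Xfree Xker.
have XY : X *m Y = 0.
  have -> : X *m Y = X *m (Y *m R) *m R' by rewrite -!mulmxA RR mulmx1.
  by rewrite YR XB mul0mx.
pose D := R *m T *m R'.
have TY : T *m Y = Y *m D.
  have -> : T *m Y = T *m (Y *m R) *m R' by rewrite -!mulmxA RR mulmx1.
  by rewrite YR TB -YR /D !mulmxA.
(* A projection along the column space of [B]; it kills [B], so it factors through [X], which gives
   the section [X']. *)
pose P := 1%:M - Y *m Y'.
have PB : P *m B = 0.
  by rewrite /P mulmxBl mul1mx -YR mulmxA -[Y *m Y' *m Y]mulmxA YY mulmx1 subrr.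
pose X' := P *m pinvmx X.
have YX : Y *m Y' + X' *m X = 1%:M by rewrite (Xker _ _ PB) addrC subrK.
have XX : X *m X' = 1%:M.
  have : X *m (Y *m Y' + X' *m X) = X by rewrite YX mulmx1.
  rewrite mulmxDr mulmxA XY mul0mx add0r mulmxA => E.
  by apply: (row_free_inj Xfree); rewrite mul1mx.
pose A := X *m T *m X'.
have XT : X *m T = A *m X.
  rewrite -[LHS]mulmx1 -YX mulmxDr mulmxA -[X *m T *m Y]mulmxA TY mulmxA XY.
  by rewrite !mul0mx add0r mulmxA.
clearbody A D.
have uA : A \in unitmx.
  have AX : A *m (X *m invmx T *m X') = 1%:M.
    have -> : A *m (X *m invmx T *m X') = A *m X *m invmx T *m X' by rewrite !mulmxA.
    by rewrite -XT -(mulmxA X) (mulmxV uT) mulmx1 XX.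
  exact: (proj1 (mulmx1_unit AX)).
have uD : D \in unitmx.
  have YD : (Y' *m invmx T *m Y) *m D = 1%:M.
    by rewrite -mulmxA -TY mulmxA -(mulmxA Y') (mulVmx uT) mulmx1 YY.
  exact: (proj2 (mulmx1_unit YD)).
have [CA AC] := IHn _ rX A uA.
have [CD DC] := IHn _ rB D uD.
pose C := Num.max 1 (Num.max CA CD).
apply: (triangular_quasi_mul XT TY YX XX YY uA uD (C := C)).
- by rewrite le_max lexx.
- by apply: quasi_mul_weaken AC; rewrite !le_max lexx orbT.
- by apply: quasi_mul_weaken DC; rewrite !le_max lexx !orbT.
Qed.

End QuasiMultiplicativePowers.

(** * The translated map on the sphere and its inverse *)

Section SphereMap.
Variables (p : nat) (hp : prime p) (n : nat).
Local Notation Q := (Qp hp).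
Local Notation S := (@padic_sphere p hp n).

Lemma mnorm_sphere (x : S) : mnorm (val x) = 1.
Proof. by have := valP x; rewrite inE -padic_normE. Qed.

(** The scaled vector has norm 1/|v|, so normalization cancels exactly the scalar. This is how the
    map and its inverse undo each other. *)
Lemma padic_normalizeZ (u v : 'cV[Q]_n) : mnorm u = 1 -> v != 0 ->
  padic_normalize (ratr (padic_norm v) *: u) = u.
Proof.
move=> u1 v0; rewrite /padic_normalize padic_normZ (qp_abs_ratr_norm v0) [padic_norm u]padic_normE u1.
by rewrite mulr1 scalerA -padic_normE (ratr_padic_normV v0) scale1r.
Qed.

Lemma mnorm_unit_neq0 (T : 'M[Q]_n) (u : 'cV[Q]_n) : T \in unitmx -> u != 0 -> T *m u != 0.
Proof.
move=> uT; apply: contraNneq => Tu.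
by rewrite -[u](mulKmx uT) Tu mulmx0.
Qed.

Lemma normalize_scale (v : 'cV[Q]_n) : v != 0 -> exists2 s : Q,
  padic_normalize v = s *: v & s = ratr (padic_norm v) /\ qp_abs s = (mnorm v)^-1.
Proof. by move=> v0; exists (ratr (padic_norm v)); rewrite ?qp_abs_ratr_norm. Qed.

Section Translate.
Variables (T : 'M[Q]_n) (b : 'cV[Q]_n).
Hypotheses (uT : T \in unitmx) (b1 : mnorm b < 1).

Local Notation f := (Tbar_a T (T *m b)).

Lemma mnorm_translate (x : S) : mnorm (val x + b) = 1.
Proof. by rewrite mnormD_eq mnorm_sphere. Qed.

Lemma translate_neq0 (x : S) : val x + b != 0.
Proof. by rewrite -mnorm_gt0 mnorm_translate. Qed.

Lemma translate_image_neq0 (x : S) : T *m (val x + b) != 0.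
Proof. exact: mnorm_unit_neq0 (translate_neq0 x). Qed.

Lemma val_translate (x : S) : val (f x) = padic_normalize (T *m (val x + b)).
Proof.
rewrite val_Tbar_a // ?(mulKmx uT); first by rewrite mulmxDr addrC.
by rewrite padic_normE => b1'; move: b1; rewrite b1' ltxx.
Qed.

(** Since x + b has norm 1, it is recovered as the normalization of T^-1 y. For invertible [T] and
    |b| < 1 the default [y] is never taken. *)
Definition translate_inv (y : S) : S :=
  insubd y (padic_normalize (invmx T *m val y) - b).

Lemma sphere_neq0 (x : S) : val x != 0.
Proof. by rewrite -mnorm_gt0 mnorm_sphere. Qed.

Lemma invT_neq0 (y : S) : invmx T *m val y != 0.
Proof. by apply: mnorm_unit_neq0 (sphere_neq0 y); rewrite unitmx_inv. Qed.

Lemma val_translate_inv (y : S) :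
  val (translate_inv y) = padic_normalize (invmx T *m val y) - b.
Proof.
rewrite insubdK // inE /padic_sphere /= padic_normE.
by rewrite mnormD_eq ?mnormN mnorm_normalize ?invT_neq0.
Qed.

Lemma translateK : cancel f translate_inv.
Proof.
move=> x; apply: val_inj; rewrite val_translate_inv val_translate.
rewrite {2}/padic_normalize -scalemxAr (mulKmx uT).
by rewrite (padic_normalizeZ (mnorm_translate x) (translate_image_neq0 x)) addrK.
Qed.

Lemma translate_invK : cancel translate_inv f.
Proof.
move=> y; apply: val_inj; rewrite val_translate val_translate_inv subrK.
rewrite {2}/padic_normalize -scalemxAr (mulKVmx uT).
exact: (padic_normalizeZ (mnorm_sphere y) (invT_neq0 y)).
Qed.

End Translate.

End SphereMap.

(** * Separation of orbits for conformal matrices *)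

Section Conformal.
Variables (p : nat) (hp : prime p) (n : nat).
Local Notation Q := (Qp hp).
Local Notation S := (@padic_sphere p hp n).
Variables (T : 'M[Q]_n) (b : 'cV[Q]_n) (C : rat).
Hypotheses (uT : T \in unitmx) (b1 : mnorm b < 1) (Cb : C * mnorm b < 1).
Hypothesis TC : forall k, mnorm (T ^+ k) * mnorm (invmx T ^+ k) <= C.

Local Notation f := (Tbar_a T (T *m b)).

Definition mxpower (P : 'M[Q]_n) : Prop := exists k, P = T ^+ k \/ P = invmx T ^+ k.

Lemma mxpower1 : mxpower 1%:M.
Proof. by exists 0%N; left. Qed.

Lemma mxpowerM P : mxpower P -> mxpower (P *m T).
Proof.
move=> [k [->|->]]; first by exists k.+1; left; rewrite expmxSr.
case: k => [|k]; first by exists 1%N; left; rewrite expr1 expr0 mul1mx.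
by exists k; right; rewrite expmxSr (mulmxKV uT).
Qed.

Lemma mxpowerV P : mxpower P -> mxpower (P *m invmx T).
Proof.
move=> [k [->|->]]; last by exists k.+1; right; rewrite expmxSr.
case: k => [|k]; first by exists 1%N; right; rewrite expr1 expr0 mul1mx.
by exists k; left; rewrite expmxSr (mulmxK uT).
Qed.

Lemma mxpower_conformal P : mxpower P ->
  exists2 P' : 'M[Q]_n, P' *m P = 1%:M & mnorm P * mnorm P' <= C.
Proof.
move=> [k [->|->]].
  by exists (invmx T ^+ k); [exact: expmx_Vmul|exact: TC].
by exists (T ^+ k); [exact: expmx_mulV|rewrite mulrC; exact: TC].
Qed.

(** Here 1 = |x| <= |P^-1| |P x|, and |P| |P^-1| <= C. *)
Lemma conformal_le P (x : S) (v : 'cV[Q]_n) : mxpower P ->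
  mnorm (P *m v) <= C * mnorm v * mnorm (P *m val x).
Proof.
move=> /mxpower_conformal[P' P'P PC].
have x1 : 1 <= mnorm P' * mnorm (P *m val x).
  rewrite -[X in X <= _](mnorm_sphere x) -{1}[val x]mul1mx -P'P -mulmxA.
  exact: mnormM.
apply: le_trans (mnormM _ _) _.
have -> : mnorm P * mnorm v = mnorm P * mnorm v * 1 by rewrite mulr1.
apply: le_trans (ler_wpM2l _ x1) _; first by rewrite mulr_ge0 ?mnorm_ge0.
have -> : mnorm P * mnorm v * (mnorm P' * mnorm (P *m val x)) =
  mnorm P * mnorm P' * (mnorm v * mnorm (P *m val x)) by ring.
by rewrite -[X in _ <= X]mulrA ler_wpM2r // mulr_ge0 ?mnorm_ge0.
Qed.

Lemma mxpower_gt0 P (x : S) : mxpower P -> 0 < mnorm (P *m val x).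
Proof.
move=> /mxpower_conformal[P' P'P _]; rewrite mnorm_gt0; apply/eqP => Px.
have := sphere_neq0 x; rewrite -[val x]mul1mx -P'P -mulmxA Px mulmx0.
by rewrite eqxx.
Qed.

(** As C |b| < 1, the vector P b is strictly smaller than P x. *)
Lemma conformal_translate P (x : S) : mxpower P ->
  mnorm (P *m (val x + b)) = mnorm (P *m val x).
Proof.
move=> PP; rewrite mulmxDr mnormD_eq //.
apply: le_lt_trans (conformal_le x b PP) _.
by rewrite gtr_pMl ?mxpower_gt0.
Qed.

(* Unlike closeness in norm, this relation is invariant under the whole orbit
   of the pair, and conformality makes it comparable to closeness in norm. *)
Definition shadows (r : rat) (x y : S) : Prop :=
  forall P, mxpower P -> mnorm (P *m (val x - val y)) <= r * mnorm (P *m val x).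

Lemma shadows_mnorm r (x y : S) P : r < 1 -> shadows r x y -> mxpower P ->
  mnorm (P *m val y) = mnorm (P *m val x).
Proof.
move=> r1 xy PP; apply: mnorm_near; rewrite -mulmxBr.
apply: le_lt_trans (xy P PP) _.
by rewrite gtr_pMl ?mxpower_gt0.
Qed.

(** Once T (x + b) and T (y + b) have the same norm, both are rescaled by the same [s], the
    translation cancels in the difference, and the condition for [P] on the images is that for P T
    on the points. *)
Lemma shadows_step r (x y : S) : r < 1 -> shadows r x y <-> shadows r (f x) (f y).
Proof.
move=> r1; have T1 : mxpower (1%:M *m T) by apply: mxpowerM; apply: mxpower1.
rewrite mul1mx in T1.
have V1 : mxpower (1%:M *m invmx T) by apply: mxpowerV; apply: mxpower1.
rewrite mul1mx in V1.
have [s fx [sE s1]] := normalize_scale (translate_image_neq0 uT b1 x).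
have [s' fy [s'E s'1]] := normalize_scale (translate_image_neq0 uT b1 y).
rewrite -(val_translate uT b1) in fx; rewrite -(val_translate uT b1) in fy.
have s0 : 0 < qp_abs s by rewrite s1 invr_gt0 mnorm_gt0 translate_image_neq0.
have same : mnorm (T *m (val y + b)) = mnorm (T *m (val x + b)) ->
    (forall P : 'M[Q]_n, mnorm (P *m (val (f x) - val (f y))) =
        qp_abs s * mnorm (P *m T *m (val x - val y))) /\
    (forall P, mxpower P -> mnorm (P *m val (f x)) = qp_abs s * mnorm (P *m T *m val x)).
  move=> xy; have ss : s' = s by rewrite s'E sE !padic_normE xy.
  split=> P; last first.
    move=> PP; rewrite fx -scalemxAr mnormZ mulmxA.
    by rewrite (conformal_translate x (mxpowerM PP)).
  rewrite fx fy ss -scalerBr -scalemxAr mnormZ -mulmxBr mulmxA.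
  by rewrite opprD addrACA subrr addr0.
split=> xy.
  have [|fxy fxE] := same.
    by rewrite !(conformal_translate _ T1) (shadows_mnorm r1 xy T1).
  move=> P PP; rewrite fxy (fxE _ PP) mulrCA (ler_pM2l s0).
  by apply: xy; apply: mxpowerM.
(* Backwards, the power T^-1 sends the images to s (x + b) and s' (y + b), of norms |s| and |s'|, so
   these agree. *)
have [|fxy fxE] := same.
  have := shadows_mnorm r1 xy V1.
  rewrite fx fy -!scalemxAr !(mulKmx uT) !mnormZ !(mnorm_translate b1) !mulr1 s1 s'1.
  exact: invr_inj.
move=> P PP; have PV := mxpowerV PP.
have := xy _ PV; rewrite fxy (fxE _ PV) (mulmxKV uT) mulrCA (ler_pM2l s0) => H.
exact: H.
Qed.

Lemma shadows_iterz r (x y : S) (k : int) : r < 1 ->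
  shadows r (iterz f k x) (iterz f k y) -> shadows r x y.
Proof.
move=> r1; case: k => k /=.
  by elim: k => // k IH xy; apply: IH; apply/(shadows_step _ _ r1).
rewrite (pinv_cancel (translateK uT b1) (translate_invK uT b1)) -!iterS.
elim: k.+1 => // m IH xy; apply: IH.
by move/(shadows_step _ _ r1): xy; rewrite !iterS !(translate_invK uT b1).
Qed.

(** Closeness of the iterates implies [shadows (C * d)] for them, invariance transports this to [x]
    and [y], and the power 1 turns it back into closeness. *)
Lemma conformal_separation (x y : S) (k : int) d : C * d < 1 ->
  mnorm (val (iterz f k x) - val (iterz f k y)) <= d ->
  mnorm (val x - val y) <= C * d.
Proof.
move=> Cd xyd; have C0 : 0 <= C by apply: le_trans (TC 0); rewrite mulr_ge0 ?mnorm_ge0.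
suff /(_ _ mxpower1) : shadows (C * d) x y by rewrite !mul1mx mnorm_sphere mulr1.
apply: (shadows_iterz (k := k)) => // P PP.
apply: le_trans (conformal_le (iterz f k x) _ PP) _.
by rewrite ler_wpM2r ?mnorm_ge0 // ler_wpM2l.
Qed.

End Conformal.

(** * Orbits of maximal growth and asymptotic pairs *)

Section NonConformal.
Variables (p : nat) (hp : prime p) (n : nat).
Local Notation Q := (Qp hp).
Local Notation S := (@padic_sphere p hp n).
Variables (T : 'M[Q]_n) (C : rat).
Hypotheses (uT : T \in unitmx) (C1 : 1 <= C) (TC : quasi_mul T C).

Let C0 : 0 < C. Proof. exact: lt_le_trans C1. Qed.

(** The column at one basis vector w attains the norm of T^k for arbitrarily large k. For such k >=
    m, |T^(k-m)| |T^m| <= C |T^k w| <= C |T^(k-m)| |T^m w|, and the common factor cancels. *)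
Lemma maximal_growth_column (F : set_system nat) : (0 < n)%N -> UltraFilter F ->
  (forall m, F [set k | (m <= k)%N]) ->
  exists j : 'I_n, forall m, mnorm (T ^+ m) <= C * mnorm (T ^+ m *m delta_mx j (0 : 'I_1)).
Proof.
move=> n0 FU Ffree.
have /choice[g gP] : forall k, exists j, mnorm (T ^+ k) = mnorm (T ^+ k *m delta_mx j (0 : 'I_1)).
  by move=> k; apply: mnorm_col; apply: expmx_neq0.
have [j jP] := ultra_finite_fiber g FU.
exists j => m.
have [k [/= gk mk]] := filter_ex (filterI jP (Ffree m)).
have := gP k; rewrite gk => Tk.
have Tkm0 : 0 < mnorm (T ^+ (k - m)) by rewrite mnorm_gt0 expmx_neq0.
rewrite -(ler_pM2r Tkm0); apply: le_trans (TC _ _) _.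
rewrite subnKC // -mulrA ler_pM2l // Tk mulrC.
have -> : T ^+ k = T ^+ (k - m) *m T ^+ m by rewrite -expmxD subnK.
by rewrite -mulmxA mnormM.
Qed.

Variables (w : 'cV[Q]_n) (c : Q) (x0 : S).
Hypothesis wP : forall m, mnorm (T ^+ m) <= C * mnorm (T ^+ m *m w).
Hypotheses (x0w : val x0 = w) (cC : qp_abs c * C ^+ 2 < 1).

Local Notation f := (Tbar_a T (T *m (c *: w))).

Let w1 : mnorm w = 1. Proof. by rewrite -x0w mnorm_sphere. Qed.

Let b1 : mnorm (c *: w) < 1.
Proof.
rewrite mnormZ w1 mulr1; apply: le_lt_trans cC.
by rewrite ler_peMr ?qp_abs_ge0 ?exprn_ege1.
Qed.

Let Tw0 m : 0 < mnorm (T ^+ m *m w).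
Proof.
rewrite mnorm_gt0; apply/eqP => Tw.
have := sphere_neq0 x0; rewrite x0w -[w]mul1mx -(expmx_Vmul m uT) -mulmxA Tw mulmx0.
by rewrite eqxx.
Qed.

(* By quasi-multiplicativity the translation by c w is too small to change any of these norms. *)
Lemma translate_orbit_mnorm k (u : 'cV[Q]_n) :
  (forall j, mnorm (T ^+ j *m u) * mnorm (T ^+ k *m w) = mnorm (T ^+ (j + k) *m w)) ->
  forall j, mnorm (T ^+ j *m (u + c *: w)) * mnorm (T ^+ k *m w) = mnorm (T ^+ (j + k) *m w).
Proof.
move=> uE j; rewrite -uE; congr (_ * _); rewrite mulmxDr; apply: mnormD_eq.
rewrite -(ltr_pM2r (Tw0 k)) uE -scalemxAr mnormZ.
have Tj0 : 0 < mnorm (T ^+ (j + k) *m w) by apply: Tw0.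
have H : mnorm (T ^+ j *m w) * mnorm (T ^+ k *m w) <= C ^+ 2 * mnorm (T ^+ (j + k) *m w).
  apply: le_trans (ler_pM (mnorm_ge0 _) (mnorm_ge0 _) (mnormM _ _) (mnormM _ _)) _.
  rewrite w1 !mulr1; apply: le_trans (TC _ _) _.
  by rewrite expr2 -mulrA ler_pM2l // wP.
rewrite -mulrA; apply: le_lt_trans (ler_wpM2l (qp_abs_ge0 c) H) _.
by rewrite mulrA gtr_pMl.
Qed.

(** For c = 0 the k-th point is T^k w rescaled to norm 1. By induction the translations leave the
    norms of its images under the T^j unchanged. *)
Lemma orbit_mnorm k j :
  mnorm (T ^+ j *m val (iter k f x0)) * mnorm (T ^+ k *m w) = mnorm (T ^+ (j + k) *m w).
Proof.
elim: k j => [|k IH] j; first by rewrite expr0 mul1mx w1 mulr1 addn0 /= x0w.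
have main := translate_orbit_mnorm IH.
rewrite iterS (val_translate uT b1).
have T0 := translate_image_neq0 uT b1 (iter k f x0).
rewrite /padic_normalize -scalemxAr mnormZ (qp_abs_ratr_norm T0).
have m1 := main 1%N; rewrite expr1 add1n in m1.
have mj := main j.+1; rewrite expmxSr -mulmxA addSn -addnS in mj.
have E (t a d : rat) : t != 0 -> t^-1 * a * (t * d) = a * d by move=> t0; field.
rewrite -mj -m1; apply: E; rewrite mnorm_eq0; exact: T0.
Qed.

Variables (v : 'cV[Q]_n) (y0 : S).
Hypotheses (y0w : val y0 = w + v) (vC : mnorm v * C < 1).

(** At each step the image of the difference is smaller than the image of the point, because
    |T^(k+1) v| < |T^(k+1) w|. Hence both points are rescaled by the same factor, and the
    translation cancels. *)
Lemma orbit_diff k : exists2 s : Q,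
  val (iter k f y0) - val (iter k f x0) = s *: (T ^+ k *m v)
  & qp_abs s = (mnorm (T ^+ k *m w))^-1.
Proof.
elim: k => [|k [s sE s1]].
  exists 1; last by rewrite expr0 mul1mx w1 invr1 qp_abs1.
  by rewrite expr0 mul1mx scale1r /= x0w y0w addrC addKr.
rewrite !iterS !(val_translate uT b1).
set xk := iter k f x0 in sE *; set yk := iter k f y0 in sE *.
have Tx0 := translate_image_neq0 uT b1 xk.
have TxE : mnorm (T *m (val xk + c *: w)) = mnorm (T ^+ k.+1 *m w) / mnorm (T ^+ k *m w).
  have := translate_orbit_mnorm (orbit_mnorm k) 1; rewrite expr1 add1n -/xk => <-.
  by rewrite mulfK ?gt_eqF.
have TyE : T *m (val yk + c *: w) = T *m (val xk + c *: w) + s *: (T ^+ k.+1 *m v).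
  have -> : val yk = val xk + s *: (T ^+ k *m v) by rewrite -sE addrC subrK.
  by rewrite addrAC [LHS]mulmxDr -scalemxAr mulmxA -expmxS.
have same : mnorm (T *m (val yk + c *: w)) = mnorm (T *m (val xk + c *: w)).
  rewrite TyE; apply: mnormD_eq; rewrite mnormZ s1 TxE mulrC ltr_pM2r ?invr_gt0 //.
  apply: le_lt_trans (mnormM _ _) _.
  apply: le_lt_trans (ler_wpM2r (mnorm_ge0 v) (wP k.+1)) _.
  by rewrite mulrAC gtr_pMl // mulrC.
exists (ratr (padic_norm (T *m (val xk + c *: w))) * s).
  rewrite /padic_normalize padic_normE same -padic_normE TyE scalerDr scalerA.
  by rewrite [LHS]addrC addKr.
have t0 : mnorm (T ^+ k *m w) != 0 by rewrite gt_eqF.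
rewrite qp_absM (qp_abs_ratr_norm Tx0) s1 TxE -invfM (divfK t0).
reflexivity.
Qed.

End NonConformal.

(** [K] is the square of the constant of quasi-multiplicativity: for |c| below its inverse,
    translating by [c *: w] does not affect the growth of the orbit of [w]. *)
Lemma nonconformal_asymptotic p (hp : prime p) n (T : 'M[Qp hp]_n) : T \in unitmx ->
  ~ conformal T -> exists (w : 'cV[Qp hp]_n) (K : rat), [/\ w != 0, 0 < K &
    forall c : Qp hp, qp_abs c * K < 1 ->
    mnorm (c *: w) < 1 /\
    exists (x y : @padic_sphere p hp n) (F : set_system nat), [/\ x <> y, UltraFilter F &
      forall e, 0 < e -> F [set k | mnorm (val (iter k (Tbar_a T (T *m (c *: w))) y)
        - val (iter k (Tbar_a T (T *m (c *: w))) x)) <= e]]].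
Proof.
move=> uT nT.
have n0 := nonconformal_dim nT.
have [F [FU FP]] := nonconformal_ultra nT.
have [s [B [sE sB _ B0 uB]]] := nonconformal_limit uT n0 FU FP.
have [C C1 TC] := exists_quasi_mul uT.
have C0 : 0 < C by apply: lt_le_trans C1.
have [j wP] := maximal_growth_column uT C1 TC n0 FU (nonconformal_free FU FP).
set w := delta_mx j 0 in wP.
have w1 : mnorm w = 1.
  apply/eqP; rewrite eq_le; apply/andP; split.
    by apply/mnorm_leP => // i k; rewrite mxE; case: (_ && _); rewrite ?qp_abs0 ?qp_abs1.
  by have := le_mnorm w j 0; rewrite mxE !eqxx qp_abs1.
have w0 : w != 0 by rewrite -mnorm_gt0 w1.
have [v0 [v00 Bv0]] : exists v : 'cV_n, v != 0 /\ B *m v = 0.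
  have K0 : cokermx B != 0.
    rewrite -mxrank_eq0 mxrank_coker subn_eq0 -ltnNge ltn_neqAle rank_leq_row andbT.
    by apply: contraNneq uB => rB; rewrite -row_free_unit /row_free rB.
  have [i [k [ik _]]] := mnorm_attained K0.
  exists (col k (cokermx B)); split.
    by apply: contraNneq ik => /colP/(_ i); rewrite !mxE => ->.
  by rewrite colE mulmxA mulmx_coker mul0mx.
have nv0 : 0 < mnorm v0 by rewrite mnorm_gt0.
(* [d] makes |v| C at most 1/2; then |v| < 1 also keeps w + v on the sphere. *)
have [|d d0 dv] := @qp_abs_small p hp ((mnorm v0 * C) * 2)^-1.
  by rewrite invr_gt0 !mulr_gt0.
pose v := d *: v0.
have vC : mnorm v * C < 1.
  rewrite mnormZ -mulrA; apply: le_lt_trans (ler_wpM2r _ dv) _; first by rewrite mulr_ge0 ?ltW.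
  by rewrite invfM mulrAC mulVf ?mulf_neq0 ?gt_eqF // mul1r invf_lt1 // ltr1n.
have v1 : mnorm v < 1 by apply: le_lt_trans vC; rewrite ler_peMr ?mnorm_ge0.
have wS : w \in @padic_sphere p hp n by rewrite inE /padic_sphere /= padic_normE.
have wvS : w + v \in @padic_sphere p hp n.
  by rewrite inE /padic_sphere /= padic_normE mnormD_eq w1.
pose x : @padic_sphere p hp n := Sub w wS.
pose y : @padic_sphere p hp n := Sub (w + v) wvS.
have xw : val x = w by rewrite SubK.
have yw : val y = w + v by rewrite SubK.
exists w, (C ^+ 2); split=> // [|c cC]; first by rewrite exprn_gt0.
split.
  rewrite mnormZ w1 mulr1; apply: le_lt_trans cC.
  by rewrite ler_peMr ?qp_abs_ge0 ?exprn_ege1.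
exists x, y, F; split=> //.
  move/(congr1 val); rewrite xw yw => /eqP; rewrite -subr_eq0 opprD addrA subrr add0r oppr_eq0.
  by rewrite /v scaler_eq0 (negbTE d0) (negbTE v00).
(* This local [K] collects the losses: [C] from the growth of [w], the rest from the norm of
   [d *: v0]. *)
move=> e e0; pose K := C * qp_abs d * mnorm v0.
have ad0 : 0 < qp_abs d by rewrite lt0r qp_abs_eq0 d0 qp_abs_ge0.
have K0 : 0 < K := mulr_gt0 (mulr_gt0 C0 ad0) nv0.
have eK : 0 < e / K by rewrite divr_gt0.
apply: filterS (sB (e / K) eK) => k /= kB.
have [r rE r1] := orbit_diff uT C1 TC wP xw cC yw vC k.
rewrite rE mnormZ r1 -scalemxAr mnormZ.
have Tk0 : 0 < mnorm (T ^+ k) by rewrite mnorm_gt0 expmx_neq0.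
have Tw0 : 0 < mnorm (T ^+ k *m w).
  by rewrite -(pmulr_rgt0 _ C0); apply: lt_le_trans (wP k).
rewrite mulrC ler_pdivrMr //.
have sv : mnorm (T ^+ k *m v0) <= mnorm (T ^+ k) * (e / K * mnorm v0).
  (* As B v0 = 0, subtracting [B] from the rescaled power does not change its value at [v0]. *)
  have -> : mnorm (T ^+ k *m v0) = mnorm (T ^+ k) * mnorm ((s k *: T ^+ k - B) *m v0).
    rewrite mulmxBl Bv0 subr0 -scalemxAl mnormZ sE mulrA divff ?gt_eqF ?mul1r //.
  rewrite ler_pM2l //; apply: le_trans (mnormM _ _) _.
  by rewrite ler_wpM2r ?mnorm_ge0.
apply: le_trans (ler_wpM2l (qp_abs_ge0 d) sv) _.
have -> : qp_abs d * (mnorm (T ^+ k) * (e / K * mnorm v0)) = mnorm (T ^+ k) * (e / C).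
  rewrite /K; have ad : qp_abs d != 0 by rewrite gt_eqF.
  have C0' : C != 0 by rewrite gt_eqF.
  have nv : mnorm v0 != 0 by rewrite gt_eqF.
  by move: (mnorm (T ^+ k)) (qp_abs d) (mnorm v0) ad nv => t a b a0 b0; field; rewrite a0 b0 C0'.
rewrite mulrC mulrAC ler_pdivrMr // -mulrA ler_pM2l // [_ * C]mulrC.
exact: wP.
Qed.

(** * Topology of the sphere and distality *)

Section SphereTopology.
Variables (p : nat) (hp : prime p) (n : nat).
Local Notation Q := (Qp hp).
Local Notation S := (@padic_sphere p hp n).

Lemma nbhs_mnormP (x : 'cV[Q]_n) (A : set 'cV[Q]_n) :
  nbhs x A <-> exists2 e : rat, 0 < e & forall y, mnorm (x - y) < e -> A y.
Proof.
split=> [/nbhs_ballP[e /= e0 xA]|[e e0 xA]].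
  exists e => // y xy; apply: xA; split=> // i j.
  apply: le_lt_trans xy; have := le_mnorm (x - y) i j.
  by rewrite !mxE.
apply/nbhs_ballP; exists e => //= y [_ xy]; apply: xA.
have [->|/mnorm_attained[i [j [_ ->]]]] := eqVneq (x - y) 0; first by rewrite mnorm0.
by have := xy i j; rewrite !mxE.
Qed.

Lemma nbhs_sphereP (x : S) (A : set S) :
  nbhs x A <-> exists2 e : rat, 0 < e & forall y : S, mnorm (val x - val y) < e -> A y.
Proof.
split=> [|[e e0 xA]].
  rewrite nbhsE => -[U [[B Bo BU] Ux] UA].
  have /nbhs_mnormP[e e0 xB] : nbhs (val x) B.
    by apply: open_nbhs_nbhs; split=> //; move: Ux; rewrite -BU.
  by exists e => // y /xB By; apply: UA; rewrite -BU.
have B : nbhs (val x) [set v | mnorm (val x - v) < e] by apply/nbhs_mnormP; exists e.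
by apply: (filterS (F := nbhs x)) (@initial_continuous S _ set_val x _ B) => y; apply: xA.
Qed.

(** Bounded matrices have a limit along an ultrafilter, and the ball is closed because a nonzero
    limit has the same norm as all nearby points. *)
Lemma compact_mnorm_ball r : compact [set a : 'cV[Q]_n | mnorm a <= r].
Proof.
rewrite compact_ultra => F FU Fr.
have [l lP] := mx_ultra_limit (u := id) FU Fr.
have Fl : F --> l.
  move=> A /nbhs_mnormP[e e0 eA].
  have e20 : 0 < e / 2 by rewrite divr_gt0.
  apply: filterS (lP _ e20) => t /= tl; apply: eA.
  by rewrite mnorm_distC; apply: le_lt_trans tl _; rewrite ltr_pdivrMr // ltr_pMr ?ltr1n.
exists l; split=> //=.
have [l0|l0] := eqVneq l 0.
  have [t /= tr] := filter_ex Fr.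
  by rewrite l0 mnorm0; apply: le_trans tr; apply: mnorm_ge0.
have l2 : 0 < mnorm l / 2 by rewrite divr_gt0 ?mnorm_gt0.
have [t [/= tl tr]] := filter_ex (filterI (lP _ l2) Fr).
rewrite -(@mnorm_near _ _ _ _ l t) // mnorm_distC; apply: le_lt_trans tl _.
by rewrite ltr_pdivrMr // ltr_pMr ?ltr1n // mnorm_gt0.
Qed.

(** Around each of its points the ball contains an open ball of the same radius. *)
Lemma open_mnorm_ball r : 0 < r -> open [set a : 'cV[Q]_n | mnorm a <= r].
Proof.
move=> r0; rewrite openE => a /= ar; apply/nbhs_mnormP; exists r => // y ay.
rewrite /= -[y](subKr a); apply: mnormB_le => //; exact: ltW.
Qed.

Lemma additive_mnorm_ball r : 0 <= r -> additive_subgroup [set a : 'cV[Q]_n | mnorm a <= r].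
Proof. by move=> r0; split=> [|x y xr yr] /=; [rewrite mnorm0|apply: mnormB_le]. Qed.

(** The norm before normalization is locally constant, so [h] is locally affine. The form covers the
    map, with t = 0, and its inverse, with u = 0. *)
Lemma continuous_affine_normalize (h : S -> S) (M : 'M[Q]_n) (u t : 'cV[Q]_n) :
  (forall x : S, M *m val x + u != 0) ->
  (forall x, val (h x) = padic_normalize (M *m val x + u) + t) -> continuous h.
Proof.
move=> M0 hE x A /nbhs_sphereP[e e0 xA]; apply/nbhs_sphereP.
set v := M *m val x + u.
have N0 : 0 < mnorm v by rewrite mnorm_gt0 M0.
have K0 : 0 < mnorm M + 1 by rewrite ltr_wpDl ?mnorm_ge0.
(* The 1 in the minimum keeps the norm constant, the [e] gives closeness after normalization, and
   adding 1 keeps the denominator positive. *)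
have d0 : 0 < Num.min 1 e * mnorm v / (mnorm M + 1).
  by rewrite divr_gt0 ?mulr_gt0 // lt_min ltr01.
exists (Num.min 1 e * mnorm v / (mnorm M + 1)) => // y xy; apply: xA.
have Mxy : v - (M *m val y + u) = M *m (val x - val y).
  by rewrite mulmxBr opprD addrACA subrr addr0.
have close : mnorm (M *m (val x - val y)) < Num.min 1 e * mnorm v.
  apply: le_lt_trans (mnormM _ _) _.
  apply: (@le_lt_trans _ _ ((mnorm M + 1) * mnorm (val x - val y))).
    by rewrite ler_wpM2r ?mnorm_ge0 // lerDl.
  by rewrite mulrC -ltr_pdivlMr.
have same : mnorm (M *m val y + u) = mnorm v.
  apply: mnorm_near; rewrite Mxy; apply: lt_le_trans close _.
  by rewrite ler_piMl ?mnorm_ge0 // ge_min lexx.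
rewrite !hE opprD addrACA subrr addr0 /padic_normalize [padic_norm (M *m val y + u)]padic_normE.
rewrite same -(padic_normE v) -scalerBr mnormZ Mxy (qp_abs_ratr_norm (M0 x)) -/v.
rewrite mulrC ltr_pdivrMr //; apply: lt_le_trans close _.
by rewrite ler_wpM2r ?mnorm_ge0 // ge_min lexx orbT.
Qed.

Lemma translate_homeomorphism (T : 'M[Q]_n) (b : 'cV[Q]_n) : T \in unitmx ->
  mnorm b < 1 -> homeomorphism (Tbar_a T (T *m b)).
Proof.
move=> uT b1; exists (translate_inv T b); split.
- exact: translateK.
- exact: translate_invK.
- apply: (@continuous_affine_normalize _ T (T *m b) 0) => x; rewrite -mulmxDr.
    exact: translate_image_neq0.
  by rewrite addr0; apply: val_translate.
- apply: (@continuous_affine_normalize _ (invmx T) 0 (- b)) => x; rewrite addr0.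
    exact: invT_neq0.
  exact: val_translate_inv.
Qed.

(** A diagonal point in the closure yields iterates that are arbitrarily close, so |x - y| <= C e
    for every e > 0. *)
Lemma conformal_distal (T : 'M[Q]_n) (b : 'cV[Q]_n) C : T \in unitmx ->
  mnorm b < 1 -> C * mnorm b < 1 ->
  (forall k, mnorm (T ^+ k) * mnorm (invmx T ^+ k) <= C) -> distal (Tbar_a T (T *m b)).
Proof.
move=> uT b1 Cb TC x y xy; apply/seteqP; split=> // -[u v] [cl [d _ [du dv]]].
apply: xy; apply: val_inj; apply/eqP; rewrite -subr_eq0; apply/eqP.
have C0 : 0 <= C by apply: le_trans (TC 0%N); rewrite mulr_ge0 ?mnorm_ge0.
apply: (mnorm_small_eq0 C0) => e e0.
have C1 : 0 < C + 1 by rewrite ltr_wpDl.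
(* The cap (C + 1)^-1 secures the hypothesis C e' < 1 of [conformal_separation]. *)
pose e' := Num.min e (C + 1)^-1.
have e'0 : 0 < e' by rewrite lt_min e0 invr_gt0.
have Ce' : C * e' < 1.
  apply: (@le_lt_trans _ _ (C * (C + 1)^-1)); first by rewrite ler_wpM2l // ge_min lexx orbT.
  by rewrite ltr_pdivrMr // mul1r ltrDl.
pose A := [set z : S | mnorm (val d - val z) < e'].
have dA : nbhs d A by apply/nbhs_sphereP; exists e'.
have [_ [[k _ <-] [/= kx ky]]] : [set (iterz (Tbar_a T (T *m b)) k x,
    iterz (Tbar_a T (T *m b)) k y) | k in [set: int]] `&` (A `*` A) !=set0.
  by apply: cl; rewrite -du -dv; exists (A, A).
apply: le_trans (conformal_separation uT b1 Cb TC (k := k) Ce' _) _; last first.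
  by rewrite ler_wpM2l // ge_min lexx.
have -> : val (iterz (Tbar_a T (T *m b)) k x) - val (iterz (Tbar_a T (T *m b)) k y) =
  (val d - val (iterz (Tbar_a T (T *m b)) k y)) - (val d - val (iterz (Tbar_a T (T *m b)) k x)).
  by rewrite opprB [RHS]addrC addrA subrK.
by apply: mnormB_le; apply: ltW.
Qed.

(** The orbit of [x] has a limit along [F] by boundedness, the orbit of [y] has the same one, and it
    lies on the sphere because the norm is locally constant away from 0. *)
Lemma asymptotic_not_distal (f : S -> S) (x y : S) (F : set_system nat) :
  x <> y -> UltraFilter F ->
  (forall e, 0 < e -> F [set k | mnorm (val (iter k f y) - val (iter k f x)) <= e]) ->
  ~ distal f.
Proof.
move=> xy FU Fxy fd.
have F1 : F [set k | mnorm (val (iter k f x)) <= 1].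
  by apply: filterS filterT => k _ /=; rewrite mnorm_sphere.
have [l lP] := mx_ultra_limit FU F1.
have lS : l \in @padic_sphere p hp n.
  rewrite inE /padic_sphere /= padic_normE.
  have [|k /= kl] := filter_ex (lP 2^-1 _); first by [].
  rewrite (@mnorm_near _ _ _ _ (val (iter k f x)) l) mnorm_sphere //.
  by apply: le_lt_trans kl _.
pose d : S := Sub l lS.
have dl : val d = l by rewrite SubK.
suff : (set0 : set (S * S)) (d, d) by [].
rewrite -(fd x y xy); split; last by exists d.
move=> B [[A1 A2] [/= /nbhs_sphereP[e1 e10 e1A] /nbhs_sphereP[e2 e20 e2A]] AB].
pose e := Num.min e1 e2 / 2.
have e0 : 0 < e by rewrite divr_gt0 // lt_min e10.
have [k [/= kl kxy]] := filter_ex (filterI (lP e e0) (Fxy e e0)).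
have eM : e < Num.min e1 e2.
  by rewrite ltr_pdivrMr // ltr_pMr ?ltr1n // lt_min e10.
exists (iterz f (Posz k) x, iterz f (Posz k) y); split; first by exists (Posz k).
apply: AB; split=> /=.
  apply: e1A; rewrite dl mnorm_distC; apply: le_lt_trans kl _.
  by apply: lt_le_trans eM _; rewrite ge_min lexx.
apply: e2A; rewrite dl mnorm_distC.
have -> : val (iter k f y) - l = (val (iter k f y) - val (iter k f x)) + (val (iter k f x) - l).
  by rewrite addrA subrK.
apply: (@le_lt_trans _ _ e); first exact: mnormD_le.
by apply: lt_le_trans eM _; rewrite ge_min lexx orbT.
Qed.

Lemma Tbar_a0 (T : 'M[Q]_n) : Tbar_a T 0 = Tbar T.
Proof. by apply/funext => x; rewrite /Tbar_a add0r. Qed.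

End SphereTopology.

(** * The dichotomy for small translations *)

Theorem theorem3p2 (p : nat) (hp : prime p) (n : nat) (hn : (1 <= n)%N)
    (T : 'M[Qp hp]_n) (hT : T \in unitmx) :
  exists V : set 'cV[Qp hp]_n,
    [/\ compact V, open V & additive_subgroup V] /\
    [/\ forall a, V a -> a <> 0 ->
          padic_norm (invmx T *m a) < 1 /\ homeomorphism (Tbar_a T a),
        distal (Tbar T) ->
          forall a, V a -> a <> 0 -> distal (Tbar_a T a)
      & ~ distal (Tbar T) ->
          forall U : set 'cV[Qp hp]_n, nbhs (0 : 'cV[Qp hp]_n) U -> U `<=` V ->
            exists a, [/\ U a, a <> 0 & ~ distal (Tbar_a T a)]].
Proof.
(* Without conformality [C] is just 0, so that the radius below makes sense in both cases. *)
have [C [C0 TC]] : exists C : rat, 0 <= C /\ (conformal T ->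
    forall k, mnorm (T ^+ k) * mnorm (invmx T ^+ k) <= C).
  have [[C TC]|nT] := pselect (conformal T); last by exists 0.
  by exists C; split=> //; apply: le_trans (TC 0%N); rewrite mulr_ge0 ?mnorm_ge0.
have K0 : 0 < (C + 1) * (mnorm (invmx T) + 1).
  by rewrite mulr_gt0 ?ltr_wpDl ?mnorm_ge0.
(* With this radius (C + 1) |T^-1 a| <= 1/2 on the ball, which yields both |T^-1 a| < 1 and C |T^-1
   a| < 1. *)
pose r := ((C + 1) * (mnorm (invmx T) + 1))^-1 / 2.
have r0 : 0 < r by rewrite divr_gt0 ?invr_gt0.
have small (a : 'cV_n) : mnorm a <= r -> (C + 1) * mnorm (invmx T *m a) < 1.
  move=> ar; have H : mnorm (invmx T *m a) <= (mnorm (invmx T) + 1) * r.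
    apply: le_trans (mnormM _ _) _.
    by rewrite ler_pM ?mnorm_ge0 // lerDl.
  apply: le_lt_trans (ler_wpM2l _ H) _; first by rewrite addr_ge0.
  by rewrite mulrA /r mulrA divff ?gt_eqF // mul1r invf_lt1 // ltr1n.
have small1 (a : 'cV_n) : mnorm a <= r -> mnorm (invmx T *m a) < 1.
  move=> /small; apply: le_lt_trans.
  by rewrite ler_peMl ?mnorm_ge0 // lerDr.
exists [set a | mnorm a <= r]; split.
  split; [exact: compact_mnorm_ball|exact: open_mnorm_ball|].
  by apply: additive_mnorm_ball; apply: ltW.
split.
- move=> a ar _; rewrite padic_normE; split; first exact: small1.
  rewrite -[a](mulKVmx hT); apply: translate_homeomorphism hT _.
  exact: small1.
- move=> dT a ar _.
  (* The parameter c = 0 gives the untranslated map, whose distality therefore forces [T] to be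
     conformal. *)
  have cT : conformal T.
    apply: contrapT => nT; have [w [K [_ _ wK]]] := nonconformal_asymptotic hT nT.
    have [|_ [x [y [F [xy FU FP]]]]] := wK 0; first by rewrite qp_abs0 mul0r.
    by apply: (asymptotic_not_distal xy FU FP); rewrite scale0r mulmx0 Tbar_a0.
  have Ca : C * mnorm (invmx T *m a) < 1.
    have := small a ar; apply: le_lt_trans.
    by rewrite ler_wpM2r ?mnorm_ge0 // lerDl.
  have D := conformal_distal hT (small1 a ar) Ca (TC cT).
  by rewrite (mulKVmx hT) in D.
- move=> ndT U /nbhs_mnormP[e e0 eU] _.
  (* Conformality would make the untranslated map distal, by the case b = 0. *)
  have nT : ~ conformal T.
    move=> cT; apply: ndT; rewrite -Tbar_a0 -(mulmx0 1 T).
    by apply: (conformal_distal hT _ _ (TC cT)); rewrite mnorm0 ?mulr0.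
  have [w [K [w0 K1 wK]]] := nonconformal_asymptotic hT nT.
  have Tw0 : T *m w != 0 by apply: mnorm_unit_neq0.
  (* The bound 1/K is for the asymptotic pair, the other puts the translation in [U]; halving makes
     both strict. *)
  have m0 : 0 < Num.min K^-1 (e / mnorm (T *m w)) / 2.
    by rewrite divr_gt0 // lt_min invr_gt0 K1 divr_gt0 ?mnorm_gt0.
  have [c c0 cm] := @qp_abs_small p hp _ m0.
  have cM : qp_abs c < Num.min K^-1 (e / mnorm (T *m w)).
    apply: le_lt_trans cm _; rewrite ltr_pdivrMr // ltr_pMr ?ltr1n //.
    by rewrite lt_min invr_gt0 K1 divr_gt0 ?mnorm_gt0.
  move: cM; rewrite lt_min => /andP[cK ce].
  have [|c1 [x [y [F [xy FU FP]]]]] := wK c; first by rewrite -ltr_pdivlMr // div1r.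
  exists (T *m (c *: w)); split.
  + by apply: eU; rewrite sub0r mnormN -scalemxAr mnormZ -ltr_pdivlMr // mnorm_gt0.
  + by apply/eqP/mnorm_unit_neq0 => //; rewrite scaler_eq0 negb_or c0.
  + exact: asymptotic_not_distal xy FU FP.
Qed.
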